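(* Let $n\ge 3$. A transform $\mathcal Z:\mathrm{Conv}_{sc}(\mathbb R^n)\to F(\mathbb R^n;\mathbb R)$ is a continuous and $\mathrm{SL}(n)$ contravariant valuation such that there exist $\varepsilon\in\mathbb R$ and a function $\mathcal Z_0:\mathrm{Conv}_{sc}(\mathbb R^n)\to[0,\infty)$ for which $$\mathcal Z(\tau_y u)=\mathcal Z(u)+\ell_{\mathcal Z_0(u)y},\qquad \mathcal Z(u+\ell_y)=\tau_{\varepsilon y}\mathcal Z(u)$$ for every $u\in \mathrm{Conv}_{sc}(\mathbb R^n)$ and $y\in\mathbb R^n$, if and only if there are constants $c,c'\in\mathbb R$ and $\sigma\ge0$ such that $\mathcal Z_0\equiv\sigma$ and $$\mathcal Z u(x)=\begin{cases}\varepsilon\sigma\,u^\ast(x/\varepsilon)+c,&\varepsilon\ne0,\\ c'\delta_x^0+c,&\varepsilon=0,\end{cases}$$ for every $u\in \mathrm{Conv}_{sc}(\mathbb R^n)$ and $x\in\mathbb R^n$.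
   Context: $\mathrm{Conv}_{sc}(\mathbb R^n)$ is the set of all lower semi-continuous convex functions $u:\mathbb R^n\to\mathbb R\cup\{\infty\}$ that are proper ($u\not\equiv\infty$) and super-coercive ($\lim_{|x|\to\infty} u(x)/|x|=\infty$). $F(\mathbb R^n;\mathbb R)$ is the set of all functions $\mathbb R^n\to\mathbb R$. The Legendre transform is $u^\ast(x)=\sup_{y\in\mathbb R^n}(x\cdot y-u(y))$. $\delta_x^0$ equals $1$ if $x=o$ (the origin) and $0$ otherwise. $u\vee v$ and $u\wedge v$ denote pointwise maximum and minimum. $\mathcal Z$ is a valuation if $\mathcal Z(u\vee v)+\mathcal Z(u\wedge v)=\mathcal Z u+\mathcal Z v$ whenever $u,v,u\vee v,u\wedge v\in \mathrm{Conv}_{sc}(\mathbb R^n)$. $\mathcal Z$ is continuous if epi-convergence $u_i\to u$ in $\mathrm{Conv}_{sc}(\mathbb R^n)$ implies $\mathcal Z u_i\to\mathcal Z u$ pointwise. Epi-convergence $u_i\to u$ means: for every $x\in\mathbb R^n$, $u(x)\le\liminf_i u_i(x_i)$ for all $x_i\to x$, and there is a sequence $x_i\to x$ with $u(x)=\lim_i u_i(x_i)$. $\mathcal Z$ is $\mathrm{SL}(n)$ contravariant if $\mathcal Z(u\circ\phi^{-1})=(\mathcal Z u)\circ\phi^{t}$ for all $u\in \mathrm{Conv}_{sc}(\mathbb R^n)$ and all $\phi\in \mathrm{SL}(n)$. For $y\in\mathbb R^n$, $\tau_y f(x)=f(x-y)$ and $\ell_y(x)=x\cdot y$. *)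

(* Defs.v *)
From HB Require Import structures.
From mathcomp Require Import all_boot all_order all_algebra.
From mathcomp Require Import all_classical all_reals all_analysis.

Set Implicit Arguments.
Unset Strict Implicit.
Unset Printing Implicit Defensive.

Import Order.TTheory GRing.Theory Num.Theory.
Import numFieldNormedType.Exports.

Local Open Scope classical_set_scope.
Local Open Scope ring_scope.

Section Defs.
Context {R : realType} {n : nat}.

(* Points of R^n are column vectors.  Their library norm is the sup norm, which
   induces the usual topology but is not the Euclidean norm, hence [enorm]. *)
Local Notation E := 'cV[R]_n.

Definition dot (x y : E) : R := \sum_(i < n) x i 0 * y i 0.

Definition enorm (x : E) : R := Num.sqrt (dot x x).

Definition econvex (u : E -> \bar R) : Prop :=
  forall (x y : E) (t : R), 0 <= t <= 1 ->
    (u (t *: x + (1 - t) *: y)%R <= t%:E * u x + (1 - t)%:E * u y)%E.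

Definition proper (u : E -> \bar R) : Prop := exists x, u x != +oo%E.

(* u(x) / |x| tends to +oo as |x| tends to +oo *)
Definition super_coercive (u : E -> \bar R) : Prop :=
  forall A : R, \forall r \near +oo,
    forall x : E, r <= enorm x -> (A%:E <= u x * ((enorm x)^-1)%:E)%E.

Definition Conv_sc : set (E -> \bar R) := [set u |
  [/\ forall x, u x != -oo%E, lower_semicontinuous u, econvex u,
      proper u & super_coercive u]].

Definition legendre (u : E -> \bar R) (x : E) : \bar R :=
  ereal_sup [set ((dot x y)%:E - u y)%E | y in [set: E]].

Definition tau {T : Type} (y : E) (f : E -> T) : E -> T := fun x => f (x - y).

Definition epi_cvg (u_ : nat -> E -> \bar R) (u : E -> \bar R) : Prop :=
  forall x : E,
    (forall x_ : nat -> E, x_ @ \oo --> x ->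
       (u x <= limn_einf (fun i => u_ i (x_ i)))%E) /\
    (exists x_ : nat -> E, x_ @ \oo --> x /\
       (fun i => u_ i (x_ i)) @ \oo --> u x).

(* A transform Conv_sc -> F(R^n; R) is encoded by a function on all of
   E -> \bar R; nothing below depends on its values outside Conv_sc. *)
Implicit Type Z : (E -> \bar R) -> E -> R.

Definition valuation Z : Prop :=
  forall u v : E -> \bar R,
    let umaxv := fun x => Order.max (u x) (v x) in
    let uminv := fun x => Order.min (u x) (v x) in
    Conv_sc u -> Conv_sc v -> Conv_sc umaxv -> Conv_sc uminv ->
    forall x, Z umaxv x + Z uminv x = Z u x + Z v x.

Definition epi_continuous Z : Prop :=
  forall (u_ : nat -> E -> \bar R) (u : E -> \bar R),
    (forall i, Conv_sc (u_ i)) -> Conv_sc u -> epi_cvg u_ u ->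
    forall x, (fun i => Z (u_ i) x) @ \oo --> Z u x.

Definition SL_contravariant Z : Prop :=
  forall (u : E -> \bar R) (phi : 'M[R]_n), Conv_sc u -> \det phi = 1 ->
    forall x, Z (fun y => u (invmx phi *m y)) x = Z u (phi^T *m x).

Definition translation_rules Z (eps : R) (Z0 : (E -> \bar R) -> R) : Prop :=
  forall (u : E -> \bar R) (y : E), Conv_sc u ->
    (forall x, Z (tau y u) x = Z u x + dot x (Z0 u *: y)) /\
    (forall x, Z (fun z => (u z + (dot z y)%:E)%E) x = tau (eps *: y) (Z u) x).

Definition admissible Z (eps : R) (Z0 : (E -> \bar R) -> R) : Prop :=
  [/\ epi_continuous Z, SL_contravariant Z, valuation Z,
      forall u, Conv_sc u -> 0 <= Z0 u & translation_rules Z eps Z0].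

Definition explicit_form Z (eps : R) (Z0 : (E -> \bar R) -> R) : Prop :=
  exists c c' sigma : R,
    [/\ 0 <= sigma, forall u, Conv_sc u -> Z0 u = sigma &
        forall (u : E -> \bar R) (x : E), Conv_sc u ->
          (Z u x)%:E =
            if eps == 0 then (c' * (x == 0)%:R + c)%:E
            else ((eps * sigma)%:E * legendre u (eps^-1 *: x)%R + c%:E)%E].

End Defs.

(* Main.v *)
Require Import Defs.
From HB Require Import structures.
From mathcomp Require Import all_boot all_order all_algebra.
From mathcomp Require Import all_classical all_reals all_analysis.
From mathcomp Require Import ring lra.

Set Implicit Arguments.
Unset Strict Implicit.
Unset Printing Implicit Defensive.

Import Order.TTheory GRing.Theory Num.Theory.
Import numFieldNormedType.Exports.

Local Open Scope classical_set_scope.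
Local Open Scope ring_scope.

(** The Legendre transform turns every operation of the statement into a simple
one: translations of [u] become linear summands, linear summands become
translations, and [phi] in SL(n) becomes its transpose.  It also turns a pointwise
minimum into a maximum, and a pointwise maximum into a minimum as soon as the
minimum of the two functions is convex ([conjugate_max]), hence it is a valuation;
and it is continuous because convexity forbids epi-convergent functions to dip far
away ([conjugate_epi_cvg]).  This gives the converse implication.

For the direct implication, everything is reduced to two rigidity results about
real functionals on [Conv_sc], both proved on the functions [hullf S] (the convex
hull of finitely many points [(a, c)] of the epigraph space), which approximate
all functions of [Conv_sc] ([approx_hull]).

- [affine_invariant_cst]: a continuous functional that is blind to affine summands
  is constant.  Adding [k * beta], where [beta] is affine, nonnegative on the
  domain and zero on a face of it, and letting [k] grow, forces the function onto
  that face ([epi_cvg_face]); after finitely many such steps only a vertex remains.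

- [invariant_valuation_cst]: for [1 < n], a continuous valuation invariant under
  SL(n), translations and the addition of constants is constant.  Let [excess S] be
  its value at [hullf S] minus its value at the indicator of a point.  SL(n)
  contains dilations of any hyperplane, so a function living on a hyperplane is
  shrunk to a point and has excess zero ([excess_hyperplane]).  Hence the excess of
  an affine function on a simplex is additive when an edge is cut
  ([simplex_cut]), and depends on the volume and the vertex heights only
  ([simplex_volume]).  It is then proportional to the volume ([simplex_half]), so
  that the excess at fixed volume is the mean of its values for the vertex heights
  of the two halves; refining, the heights become nearly constant, and
  they do not matter at all ([simplex_heights_const]).  Raising one vertex to
  infinity leaves a facet, so the excess vanishes ([simplex_excess_eq0]).  More
  than [n + 1] points are affinely dependent, and a dependency lets one cut the
  hull into hulls of fewer points ([excess_circuit]).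

If [eps] is not zero, put [Y u = Z u 0]; the linear rule gives
[Z u x = Y (u - l_(x / eps))].  Evaluating the translation rule at [w + l_q] for
nonzero [q] yields [Y (w - s) = Y w + eps * s * Z0 (w + l_q)], so the slope [D w] of
[Y] in vertical direction equals [Z0 (w + l_q)] for every such [q]; it is blind to
affine summands, and the first result makes it a constant [sigma], which is also
the value of [Z0].  Then [Y u - eps * sigma * conjugate u 0] satisfies the
hypotheses of the second result, and its constant value is [c].

If [eps = 0], then [Z] ignores linear summands, and shifting by a vector orthogonal
to [x] shows that [Z u x] ignores constants too ([eps0_affine]).  By the first
result [Z u x] depends on [x] only; so [Z0 = 0], and the transitivity of SL(n) on
nonzero vectors leaves one value at the origin and one elsewhere. *)

(** * Scalar product and norm *)

Lemma near_dist {K : realType} {W : normedModType K} (y : W) (e : K) :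
  0 < e -> \forall z \near y, `|y - z| < e.
Proof. by move=> e0; apply/nbhs_normP; exists e. Qed.

Lemma lipschitz_continuous {K : realType} {V W : normedModType K}
    (f : V -> W) (C : K) :
  (forall y z, `|f y - f z| <= C * `|y - z|) -> continuous f.
Proof.
move=> fC y; apply/cvgrPdist_lt => e e0; near=> z.
have c0 : 0 < `|C| + 1 by rewrite ltr_wpDl.
apply: le_lt_trans (fC _ _) _; apply: (@le_lt_trans _ _ ((`|C| + 1) * `|y - z|)).
  by rewrite ler_wpM2r // (le_trans (ler_norm _)) // lerDl.
rewrite -ltr_pdivlMl //; near: z.
by apply: near_dist; rewrite mulr_gt0 // invr_gt0.
Unshelve. all: by end_near. Qed.

Section Basics.
Context {R : realType} {n : nat}.
Local Notation E := 'cV[R]_n.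
Implicit Types (x y z : E).

Lemma dotC x y : dot x y = dot y x.
Proof. by apply: eq_bigr => i _; rewrite mulrC. Qed.

Lemma dotDr x y z : dot x (y + z) = dot x y + dot x z.
Proof. by rewrite -big_split; apply: eq_bigr => i _; rewrite mxE mulrDr. Qed.

Lemma dotZr a x y : dot x (a *: y) = a * dot x y.
Proof. by rewrite mulr_sumr; apply: eq_bigr => i _; rewrite mxE mulrCA. Qed.

Lemma dotNr x y : dot x (- y) = - dot x y.
Proof. by rewrite -scaleN1r dotZr mulN1r. Qed.

Lemma dotBr x y z : dot x (y - z) = dot x y - dot x z.
Proof. by rewrite dotDr dotNr. Qed.

Lemma dot0r x : dot x 0 = 0.
Proof. by rewrite -(scale0r 0) dotZr mul0r. Qed.

Lemma dotDl x y z : dot (y + z) x = dot y x + dot z x.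
Proof. by rewrite dotC dotDr !(dotC x). Qed.

Lemma dotZl a x y : dot (a *: y) x = a * dot y x.
Proof. by rewrite dotC dotZr dotC. Qed.

Lemma dotNl x y : dot (- y) x = - dot y x.
Proof. by rewrite dotC dotNr dotC. Qed.

Lemma dotBl x y z : dot (y - z) x = dot y x - dot z x.
Proof. by rewrite dotDl dotNl. Qed.

Lemma dot0l x : dot 0 x = 0.
Proof. by rewrite dotC dot0r. Qed.

Lemma dotE x y : dot x y = (x^T *m y) 0 0.
Proof. by rewrite mxE; apply: eq_bigr => i _; rewrite mxE. Qed.

Lemma dot_mulmx (M : 'M[R]_n) x y : dot x (M *m y) = dot (M^T *m x) y.
Proof. by rewrite !dotE trmx_mul trmxK mulmxA. Qed.

Lemma dot_delta x i : dot x (delta_mx i 0) = x i 0.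
Proof.
rewrite /dot (bigD1 i) //= mxE !eqxx mulr1 big1 ?addr0 // => j ji.
by rewrite mxE (negbTE ji) mulr0.
Qed.

Lemma dot_self_ge0 x : 0 <= dot x x.
Proof. by apply: sumr_ge0 => i _; rewrite -expr2 sqr_ge0. Qed.

Lemma dot_self_eq0 x : (dot x x == 0) = (x == 0).
Proof.
apply/eqP/eqP => [/eqP|->]; last by rewrite dot0l.
rewrite psumr_eq0 => [/allP h|i _]; last by rewrite -expr2 sqr_ge0.
apply/matrixP => i j; rewrite (ord1 j) mxE; apply/eqP.
by have := h i (mem_index_enum _); rewrite -expr2 sqrf_eq0.
Qed.

Lemma dot_self_gt0 x : x != 0 -> 0 < dot x x.
Proof. by rewrite lt0r dot_self_ge0 dot_self_eq0 andbT. Qed.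

Lemma coord_le_norm x i : `|x i 0| <= `|x|.
Proof.
rewrite [leRHS]/Num.norm /= mx_normrE; apply/bigmax_geP; right => /=.
by exists (i, 0).
Qed.

Lemma norm_le_coord x (r : R) : 0 <= r -> (forall i, `|x i 0| <= r) -> `|x| <= r.
Proof.
move=> r0 h; rewrite [leLHS]/Num.norm /= mx_normrE; apply/bigmax_leP; split=> //.
by move=> [i j] _ /=; rewrite (ord1 j).
Qed.

Lemma dot_le_norm x y : `|dot x y| <= n%:R * `|x| * `|y|.
Proof.
apply: le_trans (ler_norm_sum _ _ _) _.
rewrite (_ : n%:R * _ * _ = \sum_(i < n) `|x| * `|y|).
  by apply: ler_sum => i _; rewrite normrM ler_pM // coord_le_norm.
by rewrite sumr_const card_ord -mulrA mulr_natl.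
Qed.

Lemma norm_le_enorm x : `|x| <= enorm x.
Proof.
apply: norm_le_coord => [|i]; first exact: sqrtr_ge0.
rewrite -sqrtr_sqr; apply: ler_wsqrtr.
rewrite /dot (bigD1 i) //= -expr2 lerDl; apply: sumr_ge0 => j _.
by rewrite -expr2 sqr_ge0.
Qed.

Lemma enorm_le_norm x : enorm x <= n%:R * `|x|.
Proof.
rewrite -[leRHS]ger0_norm ?mulr_ge0 // -sqrtr_sqr; apply: ler_wsqrtr.
apply: le_trans (ler_norm _) _; apply: le_trans (dot_le_norm _ _) _.
rewrite -mulrA -expr2 exprMn ler_wpM2r ?sqr_ge0 // -natrX ler_nat.
by case: (n) => // m; rewrite expnS expn1 leq_pmulr.
Qed.

Lemma dot_continuous x : continuous (dot x : E -> R).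
Proof.
apply: (@lipschitz_continuous _ _ _ _ (n%:R * `|x|)) => y z.
by rewrite -dotBr; apply: dot_le_norm.
Qed.

Lemma norm_trmx (v : 'rV[R]_n) : `|v^T : E| = `|v|.
Proof.
rewrite /Num.norm /= !mx_normrE; apply/eqP; rewrite eq_le.
apply/andP; split; apply/bigmax_leP; split;
  try (by apply/bigmax_geP; left).
  move=> [i j] _ /=; apply/bigmax_geP; right => /=; exists (j, i) => //=.
  by rewrite mxE.
move=> [i j] _ /=; apply/bigmax_geP; right => /=; exists (j, i) => //=.
by rewrite mxE.
Qed.

(** The Heine-Borel property is carried over from rows to columns by transposition,
    which is an isometry. *)
Lemma compact_cball (c : E) (r : R) : compact [set x : E | `|x - c| <= r].
Proof.
have -> : [set x : E | `|x - c| <= r] =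
    (fun v : 'rV[R]_n => v^T : E) @` [set v | `|v^T - c| <= r].
  apply/seteqP; split => x /=; last by move=> [v + <-].
  by move=> h; exists x^T; rewrite ?trmxK.
apply: continuous_compact.
  apply: continuous_subspaceT; apply: (@lipschitz_continuous _ _ _ _ 1) => v w.
  by rewrite mul1r -linearB /= norm_trmx.
apply: bounded_closed_compact.
  exists (r + `|c|); split; first exact: num_real.
  move=> M rM v /= h; apply: le_trans (ltW rM).
  by rewrite -norm_trmx -lerBlDr; apply: le_trans h; exact: lerB_dist.
rewrite (_ : [set v | _] = (fun v : 'rV[R]_n => `|v^T - c|) @^-1` [set x | x <= r]) //.
apply: closed_comp => [v _|]; last exact: closed_le.
apply: (@lipschitz_continuous _ _ R^o _ 1) => {}v w.
rewrite mul1r; apply: le_trans (ler_dist_dist _ _) _.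
by rewrite opprB addrA subrK -linearB /= norm_trmx.
Qed.

End Basics.

(** * Extended reals and inferior limits *)

Section Ereal.
Context {R : realType}.

Lemma lee_realP (x y : \bar R) :
  (forall a : R, (a%:E < x)%E -> (a%:E <= y)%E) -> (x <= y)%E.
Proof.
case: x => [x| |] h; last by rewrite leNye.
- case: y h => [y| |] h; last first.
  + by have := h (x - 1); rewrite lte_fin ltrBlDr ltrDl ltr01 leeNy_eq => /(_ isT).
  + by rewrite leey.
  + rewrite lee_fin leNgt; apply/negP => yx.
    have : (x + y) / 2 < x by lra.
    by rewrite -lte_fin => /h; rewrite lee_fin; lra.
- case: y h => [y| |] h //.
  + by have := h (y + 1) (ltry _); rewrite lee_fin gerDl ler10.
  + by have := h 0 (ltry _).
Qed.

(** Inferior limits of extended reals are only ever compared with real numbers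
    below; this avoids [einfs] in all later estimates. *)
Lemma limn_einf_geP (f : nat -> \bar R) (l : \bar R) :
  (l <= limn_einf f)%E <->
  forall a : R, (a%:E < l)%E -> \forall k \near \oo, (a%:E <= f k)%E.
Proof.
have -> : limn_einf f = ereal_sup (range (einfs f)).
  by rewrite limn_einf_lim; apply/cvg_lim => //; exact: cvg_einfs_sup.
split=> [h a al|h].
  have /ereal_sup_gt[_ [N _ <-] aN] := lt_le_trans al h.
  exists N => // k /= Nk; apply: le_trans (ltW aN) _.
  by apply: ereal_inf_lbound; exists k.
apply: lee_realP => a /h[N _ hN].
apply: le_trans (ereal_sup_ubound _); last by exists N.
by apply: le_ereal_inf_tmp => _ [k /= Nk <-]; apply: hN.
Qed.

Lemma ereal_real_bound (x : \bar R) : x != +oo%E -> exists h : R, (x <= h%:E)%E.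
Proof. by case: x => [r _|/eqP//|_]; [exists r|exists 0; rewrite leNye]. Qed.

(** Functions are compared through their real sublevels, which avoids case
    analyses on infinite values. *)
Lemma eq_sublevel (x y : \bar R) :
  (forall h : R, (x <= h%:E)%E <-> (y <= h%:E)%E) -> x = y.
Proof.
move=> xy; apply/eqP; rewrite eq_le; apply/andP; split.
  apply: lee_realP => a ax; rewrite leNgt; apply/negP => /ltW /xy.
  by rewrite leNgt ax.
apply: lee_realP => a ax; rewrite leNgt; apply/negP => /ltW /xy.
by rewrite leNgt ax.
Qed.

Lemma lee_addc (x : \bar R) (c h : R) : (x + c%:E <= h%:E)%E = (x <= (h - c)%:E)%E.
Proof. by rewrite EFinB leeBrDr. Qed.

Lemma lee_caddr (x : \bar R) (c h : R) : (h%:E <= x + c%:E)%E = ((h - c)%:E <= x)%E.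
Proof. by rewrite EFinB leeBlDr. Qed.

End Ereal.

(** * Characterization of super-coercive convex functions *)

Section ConvSc.
Context {R : realType} {n : nat}.
Local Notation E := 'cV[R]_n.
Implicit Types (x y z : E) (u v : E -> \bar R).

(** Convexity of the epigraph: no product of [0] with [+oo] occurs. *)
Definition epi_convex u := forall x y h k t, 0 <= t <= 1 ->
  (u x <= h%:E)%E -> (u y <= k%:E)%E ->
  (u (t *: x + (1 - t) *: y)%R <= (t * h + (1 - t) * k)%:E)%E.

(** Super-coercivity as the existence of affine-in-the-norm minorants of every slope.
    This form involves no limit and survives affine changes of variable. *)
Definition coercive_bound u := forall A : R, exists B : R,
  forall x, ((A * `|x| - B)%:E <= u x)%E.

Lemma epi_convexP u : (forall x, u x != -oo%E) -> econvex u <-> epi_convex u.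
Proof.
move=> uN; split=> [cu x y h k t /andP[t0 t1] ux uy|cu x y t t01].
  apply: le_trans (cu _ _ _ _) _; first by rewrite t0 t1.
  rewrite [leRHS]EFinD !EFinM; apply: leeD; rewrite lee_wpmul2l // lee_fin //.
  by rewrite subr_ge0.
have [->|t0] := eqVneq t 0; first by rewrite !scale0r !add0r subr0 !scale1r !mul0e mul1e add0e.
have [->|t1] := eqVneq t 1; first by rewrite subrr !scale0r !addr0 !scale1r !mul0e mul1e adde0.
have [tp tl] : 0 < t /\ t < 1.
  by case/andP: t01; rewrite !le_eqVlt eq_sym (negbTE t0) (negbTE t1).
have tl' : 0 < 1 - t by rewrite subr_gt0.
move: (uN x) (uN y); case ux : (u x) => [a| |] // _; last first.
  move=> uyN; rewrite gt0_muley ?lte_fin //.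
  case uy : (u y) uyN => [b| |] // _; first by rewrite -EFinM addye ?leey.
  by rewrite gt0_muley ?lte_fin // ?leey.
case uy : (u y) => [b| |] // _; last first.
  by rewrite (gt0_muley (x := (1 - t)%:E)) ?lte_fin // -EFinM addey ?leey.
by rewrite -!EFinM -EFinD; apply: cu => //; rewrite ?ux ?uy.
Qed.

Lemma lsc_bounded_below u (K : set E) : (forall x, u x != -oo%E) ->
  lower_semicontinuous u -> compact K ->
  exists B : R, forall x, K x -> ((- B)%:E <= u x)%E.
Proof.
move=> uN lu /compact_near_coveringP cK.
have : \forall B \near +oo, K `<=` (fun x => ((- B)%:E <= u x)%E).
  apply: cK => x _.
  have [a au] : exists a : R, (a%:E < u x)%E.
    have := uN x; case: (u x) => [r _|_|/eqP//]; [exists (r - 1)|exists 0].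
      by rewrite lte_fin ltrBlDr ltrDl.
    by rewrite ltry.
  have [V xV Va] := lu _ _ au.
  exists (V, [set B : R | - a < B]).
    by split=> //=; apply: nbhs_pinfty_gt; exact: num_real.
  move=> [y B] /= [Vy aB]; apply: le_trans (ltW (Va _ Vy)).
  by rewrite lee_fin lerNl ltW.
by case/(@pinfty_ex_gt0 R) => B _ hB; exists B => x /hB.
Qed.

(** The minorants near the origin come from the lower bound of a lower
    semicontinuous function on a ball, those far away from super-coercivity. *)
Lemma Conv_scP u : Conv_sc u <->
  [/\ forall x, u x != -oo%E, lower_semicontinuous u, epi_convex u,
      exists x h, (u x <= h%:E)%E & coercive_bound u].
Proof.
split=> [[uN lu cu [p up] su]|[uN lu cu [p [h up]] su]]; split=> //.
- exact/epi_convexP.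
- by have [h uh] := ereal_real_bound up; exists p, h.
- move=> A; wlog A0 : A / 0 <= A => [hw|].
    have [|B hB] := hw `|A|; first exact: normr_ge0.
    exists B => x; apply: le_trans (hB x); rewrite lee_fin lerD2r.
    by rewrite ler_wpM2r // ler_norm.
  have /pinfty_ex_gt0[r r0 hr] := su A.
  have [B hB] := lsc_bounded_below uN lu (@compact_cball R n 0 r).
  exists (`|A| * r + `|B|) => x.
  have [xr|rx] := leP `|x| r.
    apply: le_trans (hB x _); last by rewrite /= subr0.
    rewrite lee_fin; have := ler_wpM2l A0 xr; have := ler_norm A.
    by have := ler_norm B; rewrite -/(GRing.opp _); nra.
  have rx' : r <= enorm x by rewrite (le_trans (ltW rx)) ?norm_le_enorm.
  have e0 : 0 < enorm x by rewrite (lt_le_trans r0).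
  have := hr _ rx'.
  rewrite lee_pdivlMr // -EFinM; apply: le_trans.
  rewrite lee_fin; have := ler_wpM2l A0 (norm_le_enorm x).
  have : 0 <= `|A| * r by rewrite mulr_ge0 // ltW.
  by have := normr_ge0 B; lra.
- exact/epi_convexP.
- by exists p; apply: contraTneq up => ->; rewrite -ltNge ltry.
move=> A.
have [B hB] := su ((`|A| + 1) * n%:R).
near=> r => x rx.
have r1 : 1 <= r by near: r; apply: nbhs_pinfty_ge; exact: num_real.
have rB : `|B| <= r by near: r; apply: nbhs_pinfty_ge; exact: num_real.
have e0 : 0 < enorm x by rewrite (lt_le_trans _ rx) // (lt_le_trans ltr01).
rewrite lee_pdivlMr // -EFinM; apply: le_trans (hB x); rewrite lee_fin.
rewrite -mulrA; have : (`|A| + 1) * enorm x <= (`|A| + 1) * (n%:R * `|x|).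
  by rewrite ler_wpM2l ?enorm_le_norm // addr_ge0.
have : A * enorm x <= `|A| * enorm x by rewrite ler_wpM2r ?ler_norm // ltW.
have := ler_norm B; rewrite mulrDl mul1r; lra.
Unshelve. all: by end_near. Qed.

End ConvSc.

(** * Affine changes of variable and epi-convergence *)

Section Ops.
Context {R : realType} {n : nat}.
Local Notation E := 'cV[R]_n.
Implicit Types (x y z : E) (u v : E -> \bar R).

Lemma lsc_near u x a : lower_semicontinuous u -> (a%:E < u x)%E ->
  \forall y \near x, (a%:E < u y)%E.
Proof. by move=> lu /lu [V xV hV]; apply: filterS xV. Qed.

Lemma mulmx_norm_le (M : 'M[R]_n) x :
  `|M *m x| <= (\sum_i \sum_j `|M i j|) * `|x|.
Proof.
have s0 : 0 <= \sum_i \sum_j `|M i j|.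
  by do 2![apply: sumr_ge0 => ? _].
apply: norm_le_coord => [|i]; first by rewrite mulr_ge0.
rewrite mxE; apply: le_trans (ler_norm_sum _ _ _) _.
apply: (@le_trans _ _ ((\sum_j `|M i j|) * `|x|)).
  rewrite mulr_suml; apply: ler_sum => j _.
  by rewrite normrM ler_wpM2l // coord_le_norm.
rewrite ler_wpM2r // [leRHS](bigD1 i) //= lerDl.
by do 2![apply: sumr_ge0 => ? _].
Qed.

Lemma affine_continuous (M : 'M[R]_n) b : continuous (fun z : E => M *m z + b : E).
Proof.
apply: (@lipschitz_continuous _ _ _ _ (\sum_i \sum_j `|M i j|)) => y z.
by rewrite opprD addrACA subrr addr0 -mulmxBr mulmx_norm_le.
Qed.

(** A single lemma covers translations, linear changes of variable and affine
    summands. *)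
Lemma Conv_sc_affine u (M : 'M[R]_n) (b q : E) (s : R) :
  M \in unitmx -> Conv_sc u ->
  Conv_sc (fun z => (u (M *m z + b)%R + (dot q z + s)%:E)%E).
Proof.
move=> Mu /Conv_scP[uN lu cu [p [h up]] su]; apply/Conv_scP; split.
- by move=> x; have := uN (M *m x + b); case: (u _) => [r| |].
- move=> x a; rewrite EFinD => ax.
  have [a' [aa' a'u]] : exists a' : R, a - (dot q x + s) < a' /\
      (a'%:E < u (M *m x + b)%R)%E.
    have := uN (M *m x + b); case: (u _) ax => [r| |//] /=; last first.
      by move=> _ _; exists (a - (dot q x + s) + 1); rewrite ltrDl ltr01 ltry.
    rewrite -!EFinD lte_fin => ar _; exists ((a - (dot q x + s) + r) / 2).
    by rewrite lte_fin; split; lra.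
  exists [set y | (a%:E < u (M *m y + b)%R + (dot q y + s)%:E)%E] => //=.
  have h1 : \forall y \near x, (a'%:E < u (M *m y + b)%R)%E.
    exact: ((@affine_continuous M b x) [set y | (a'%:E < u y)%E] (lsc_near lu a'u)).
  have h2 : \forall y \near x, a - a' - s < dot q y.
    by apply: (cvgr_gt (dot q x) (@dot_continuous _ _ q x)); lra.
  move: h1 h2; apply: filterS2 => y y1 y2 /=.
  case: (u (M *m y + b)%R) y1 => [r y1|_|]; last 2 first.
  - by rewrite addye // ltry.
  - by rewrite ltNge leNye.
  move: y1; rewrite /= -EFinD !lte_fin; lra.
- move=> x y h1 h2 t t01; rewrite !lee_addc => ux uy.
  have -> : M *m (t *: x + (1 - t) *: y) + b =
      t *: (M *m x + b) + (1 - t) *: (M *m y + b).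
    rewrite mulmxDr -!scalemxAr !scalerDr addrACA -scalerDl.
    by rewrite addrC [t + _]addrC subrK scale1r addrC.
  apply: le_trans (cu _ _ _ _ _ t01 ux uy) _.
  by rewrite lee_fin dotDr !dotZr; lra.
- exists (invmx M *m (p - b)), (h + (dot q (invmx M *m (p - b)) + s)).
  by rewrite lee_addc mulKVmx // subrK addrK.
move=> A; set C := \sum_i \sum_j `|invmx M i j|.
have C0 : 0 <= C by do 2![apply: sumr_ge0 => ? _].
set K := n%:R * `|q|.
have K0 : 0 <= K by rewrite mulr_ge0.
have [B hB] := su ((`|A| + K) * C).
exists ((`|A| + K) * C * `|b| + B - s) => x.
rewrite lee_caddr; apply: le_trans (hB _); rewrite lee_fin.
have h1 : `|x| <= C * `|M *m x|.
  by rewrite -{1}(mulKmx Mu x) mulmx_norm_le.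
have h2 : `|M *m x| <= `|M *m x + b| + `|b|.
  by rewrite -lerBlDr; apply: lerB_normD.
have h3 : `|x| <= C * (`|M *m x + b| + `|b|).
  by apply: le_trans h1 _; rewrite ler_wpM2l.
have AK : 0 <= `|A| + K by rewrite addr_ge0.
have h4 := ler_wpM2l AK h3.
have h5 : - (K * `|x|) <= dot q x.
  by rewrite lerNl (le_trans (ler_norm _)) // normrN dot_le_norm.
have h6 : A * `|x| <= `|A| * `|x| by rewrite ler_wpM2r // ler_norm.
move: h4 h5 h6; rewrite mulrDl !mulrA mulrDr; lra.
Qed.

Lemma Conv_sc_tau u y : Conv_sc u -> Conv_sc (tau y u).
Proof.
move=> /(@Conv_sc_affine u 1%:M (- y) 0 0 (unitmx1 _ _)).
congr Conv_sc; apply/funext => x.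
by rewrite mul1mx dot0l addr0 adde0.
Qed.

Lemma Conv_sc_lin u y : Conv_sc u -> Conv_sc (fun z => (u z + (dot z y)%:E)%E).
Proof.
move=> /(@Conv_sc_affine u 1%:M 0 y 0 (unitmx1 _ _)).
by congr Conv_sc; apply/funext => x; rewrite mul1mx !addr0 dotC.
Qed.

Lemma Conv_sc_cst u s : Conv_sc u -> Conv_sc (fun z => (u z + s%:E)%E).
Proof.
move=> /(@Conv_sc_affine u 1%:M 0 0 s (unitmx1 _ _)).
by congr Conv_sc; apply/funext => x; rewrite mul1mx !addr0 dot0l add0r.
Qed.

Lemma Conv_sc_mul u (M : 'M[R]_n) : M \in unitmx -> Conv_sc u ->
  Conv_sc (fun z => u (M *m z)).
Proof.
move=> Mu /(@Conv_sc_affine u M 0 0 0 Mu).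
by congr Conv_sc; apply/funext => x; rewrite !addr0 dot0l adde0.
Qed.

(** Recovery sequences are only asked to satisfy an upper bound: the matching lower
    bound is the inferior limit condition. *)
Lemma epi_cvgI (u_ : nat -> E -> \bar R) u : (forall x, u x != -oo%E) ->
  (forall x (x_ : nat -> E) a, x_ @ \oo --> x -> (a%:E < u x)%E ->
     \forall k \near \oo, (a%:E <= u_ k (x_ k))%E) ->
  (forall x h, (u x <= h%:E)%E -> exists x_ : nat -> E, x_ @ \oo --> x /\
     forall e, 0 < e -> \forall k \near \oo, (u_ k (x_ k) <= (h + e)%:E)%E) ->
  epi_cvg u_ u.
Proof.
move=> uN hl hr x; split=> [x_ cx|].
  by apply/limn_einf_geP => a; apply: hl.
case ux : (u x) => [h| |]; last by have := uN x; rewrite ux.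
  have [|x_ [cx hx]] := hr x h; first by rewrite ux.
  exists x_; split=> //.
  have hl' e : 0 < e -> \forall k \near \oo, ((h - e)%:E <= u_ k (x_ k))%E.
    by move=> e0; apply: (hl x) => //; rewrite ux lte_fin ltrBlDr ltrDl.
  apply/fine_cvgP; split.
    have := hl' 1 ltr01; have := hx 1 ltr01; apply: filterS2 => k.
    by case: (u_ k (x_ k)).
  apply/cvgrPdist_le => e e0.
  have := hl' e e0; have := hx e e0; apply: filterS2 => k /=.
  case: (u_ k (x_ k)) => [r| |] //=; rewrite !lee_fin ler_distlC => -> //.
  by move=> ->.
exists (fun=> x); split; first exact: cvg_cst.
apply/cvgeyPge => a; apply: (hl x); first exact: cvg_cst.
by rewrite ux ltry.
Qed.

Lemma epi_cvg_liminf (u_ : nat -> E -> \bar R) u x (x_ : nat -> E) a :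
  epi_cvg u_ u -> x_ @ \oo --> x -> (a%:E < u x)%E ->
  \forall k \near \oo, (a%:E <= u_ k (x_ k))%E.
Proof. by move=> /(_ x)[hl _] /hl /limn_einf_geP; apply. Qed.

Lemma epi_cvg_recovery (u_ : nat -> E -> \bar R) u x h :
  epi_cvg u_ u -> (u x <= h%:E)%E -> exists x_ : nat -> E, x_ @ \oo --> x /\
     forall e, 0 < e -> \forall k \near \oo, (u_ k (x_ k) <= (h + e)%:E)%E.
Proof.
move=> /(_ x)[_ [x_ [cx ux]]] uh; exists x_; split=> // e e0.
have uhe : (u x < (h + e)%:E)%E.
  by apply: le_lt_trans uh _; rewrite lte_fin ltrDl.
apply: (ux [set z : \bar R | (z <= (h + e)%:E)%E]).
apply: (filterS (P := [set z : \bar R | (z < (h + e)%:E)%E])) => [z /ltW //|].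
by apply: open_nbhs_nbhs; split=> //; exact: open_ereal_lt_ereal.
Qed.

Lemma epi_cvg_cst (u_ : nat -> E -> \bar R) u s : (forall x, u x != -oo%E) ->
  epi_cvg u_ u ->
  epi_cvg (fun k z => (u_ k z + s%:E)%E) (fun z => (u z + s%:E)%E).
Proof.
move=> uN uu; apply: epi_cvgI.
- by move=> x; have := uN x; case: (u x).
- move=> x x_ a cx ax; under eq_near do rewrite lee_caddr.
  apply: (epi_cvg_liminf uu cx); move: ax.
  by rewrite !ltNge EFinB leeBrDr.
move=> x h; rewrite lee_addc => /(epi_cvg_recovery uu)[x_ [cx hx]].
exists x_; split=> // e /hx; apply: filterS => k.
by rewrite lee_addc addrAC.
Qed.

End Ops.

(** * Convex hulls of finitely many points of the epigraph space *)

Section Comb.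
Context {R : realType} {n : nat}.
Local Notation E := 'cV[R]_n.
Implicit Types (x y z : E) (S T A : seq (E * R)) (s : E * R) (t h w : R).

(** Nonnegative combinations of the points of [S] of total weight [t]; convex
    combinations are the case [t = 1].  Leaving the total weight free makes the
    recursion and the sums of combinations free of divisions. *)
Fixpoint comb S t x h : Prop :=
  if S is s :: S' then
    exists2 w, 0 <= w & comb S' (t - w) (x - w *: s.1) (h - w * s.2)
  else [/\ t = 0, x = 0 & h = 0].

Lemma comb_cast S t x h t' x' h' :
  comb S t x h -> t = t' -> x = x' -> h = h' -> comb S t' x' h'.
Proof. by move=> c <- <- <-. Qed.

Lemma comb_cons s S w t x h : 0 <= w -> comb S t x h ->
  comb (s :: S) (w + t) (w *: s.1 + x) (w * s.2 + h).
Proof. by move=> w0 c; exists w => //; rewrite ![_ + _ - _]addrAC !subrr !add0r. Qed.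

Lemma comb_ge0 S t x h : comb S t x h -> 0 <= t.
Proof.
elim: S t x h => [|s S IH] t x h /=; first by case=> ->.
by case=> w w0 /IH; rewrite subr_ge0; apply: le_trans.
Qed.

Lemma comb0 S : comb S 0 0 0.
Proof. by elim: S => //= s S IH; exists 0; rewrite // scale0r mul0r !subr0. Qed.

Lemma comb_tail s S t x h : comb S t x h -> comb (s :: S) t x h.
Proof. by move=> c; exists 0; rewrite // scale0r mul0r !subr0. Qed.

Lemma combD S t x h t' x' h' :
  comb S t x h -> comb S t' x' h' -> comb S (t + t') (x + x') (h + h').
Proof.
elim: S t x h t' x' h' => [|s S IH] t x h t' x' h' /=.
  by case=> -> -> -> [-> -> ->]; rewrite !addr0.
case=> w w0 c [w' w0' c']; exists (w + w'); first exact: addr_ge0.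
apply: (comb_cast (IH _ _ _ _ _ _ c c')); [ring| |ring].
by rewrite scalerDl opprD addrACA.
Qed.

Lemma combZ S t x h r : 0 <= r -> comb S t x h -> comb S (r * t) (r *: x) (r * h).
Proof.
move=> r0; elim: S t x h => [|s S IH] t x h /=.
  by case=> -> -> ->; rewrite !mulr0 scaler0.
case=> w w0 c; exists (r * w); first exact: mulr_ge0.
apply: (comb_cast (IH _ _ _ c)); [ring| |ring].
by rewrite scalerBr scalerA.
Qed.

Lemma comb_mem S s w : s \in S -> 0 <= w -> comb S w (w *: s.1) (w * s.2).
Proof.
move=> sS w0; elim: S sS => [|a S IH] //; rewrite inE => /orP[/eqP <-|/IH c].
  by exists w => //; rewrite !subrr; exact: comb0.
exact: comb_tail.
Qed.

Lemma comb_mem1 S s : s \in S -> comb S 1 s.1 s.2.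
Proof. by move=> sS; have := comb_mem sS ler01; rewrite scale1r mul1r. Qed.

Lemma comb_subset S T t x h : {subset S <= T} -> comb S t x h -> comb T t x h.
Proof.
elim: S t x h => [|s S IH] t x h ST /=.
  by case=> -> -> ->; exact: comb0.
case=> w w0 /IH c; have {}c := c (fun a aS => ST a (mem_behead (s := s :: S) aS)).
have cs : comb T w (w *: s.1) (w * s.2) by apply: comb_mem => //; rewrite ST ?mem_head.
by apply: (comb_cast (combD cs c)); rewrite addrC subrK.
Qed.

Lemma comb_t0 S x h : comb S 0 x h -> x = 0 /\ h = 0.
Proof.
elim: S x h => [|s S IH] x h /=; first by case.
case=> w w0 c; have := comb_ge0 c; rewrite add0r oppr_ge0 => w0'.
have w00 : w = 0 by apply/eqP; rewrite eq_le w0 w0'.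
by move: c; rewrite w00 subr0 scale0r mul0r !subr0; exact: IH.
Qed.

(** A linear functional nonnegative at the points is nonnegative at their
    combinations. *)
Lemma comb_linear (f : E -> R -> R -> R) S t x h :
  (forall x x' h h' t t', f (x + x') (h + h') (t + t') = f x h t + f x' h' t') ->
  (forall r x h t, f (r *: x) (r * h) (r * t) = r * f x h t) ->
  (forall s, s \in S -> 0 <= f s.1 s.2 1) ->
  comb S t x h -> 0 <= f x h t.
Proof.
move=> fD fZ; elim: S t x h => [|s S IH] t x h fS /=.
  by case=> -> -> ->; have := fZ 0 0 0 0; rewrite !mul0r scale0r => ->.
case=> w w0 /IH c.
have -> : f x h t = f (w *: s.1) (w * s.2) (w * 1) +
    f (x - w *: s.1) (h - w * s.2) (t - w).
  by rewrite -fD mulr1 ![_ + (_ - _)]addrC !subrK.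
apply: addr_ge0; first by rewrite fZ mulr_ge0 // fS ?mem_head.
by apply: c => a aS; apply: fS; rewrite inE aS orbT.
Qed.

Lemma comb_bounded S : exists2 K : R, 0 <= K & forall t x h, comb S t x h ->
  `|x| <= K * t /\ `|h| <= K * t.
Proof.
elim: S => [|s S [K K0 IH]].
  by exists 0 => // t x h /= [-> -> ->]; rewrite !normr0 mulr0.
exists (K + `|s.1| + `|s.2|) => [|t x h /= [w w0 c]]; first by rewrite !addr_ge0.
have [cx ch] := IH _ _ _ c; have := comb_ge0 c; rewrite subr_ge0 => wt.
have t0 := le_trans w0 wt.
have h1 : `|x| <= `|x - w *: s.1| + w * `|s.1|.
  by rewrite -{1}(subrK (w *: s.1) x) (le_trans (ler_normD _ _)) // normrZ ger0_norm.
have h2 : `|h| <= `|h - w * s.2| + w * `|s.2|.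
  by rewrite -{1}(subrK (w * s.2) h) (le_trans (ler_normD _ _)) // normrM (ger0_norm w0).
have a1 := normr_ge0 s.1; have a2 := normr_ge0 s.2.
have b1 := ler_wpM2r a1 wt; have b2 := ler_wpM2r a2 wt.
have b3 := mulr_ge0 w0 K0.
have d1 := mulr_ge0 a1 t0; have d2 := mulr_ge0 a2 t0.
by split; rewrite !mulrDl; move: h1 h2 cx ch; rewrite !mulrBr; lra.
Qed.

(** By induction, as the image of a product with [[0, 1]]; the closed condition
    [z.1 <= 1] restores the bound on the total weight. *)
Lemma compact_comb S :
  compact [set z : R * (E * R) | z.1 <= 1 /\ comb S z.1 z.2.1 z.2.2].
Proof.
elim: S => [|s S IH].
  rewrite (_ : [set z | _] = [set (0, (0, 0))]); first exact: compact_set1.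
  apply/seteqP; split=> [[t [x h]] /= [_ [-> -> ->]]|_ ->] //=.
set K := [set z | _] in IH.
pose f (p : R * (R * (E * R))) : R * (E * R) :=
  (p.1 + p.2.1, (p.1 *: s.1 + p.2.2.1, p.1 * s.2 + p.2.2.2)).
have fc : continuous f.
  pose T := (R * (R * (E * R)))%type.
  have c1 : continuous (fun p : T => p.1) by move=> p; exact: cvg_fst.
  have c2 : continuous (fun p : T => p.2) by move=> p; exact: cvg_snd.
  have c21 : continuous (fun p : T => p.2.1).
    by move=> p; apply: cvg_comp (c2 p) _; exact: cvg_fst.
  have c22 : continuous (fun p : T => p.2.2).
    by move=> p; apply: cvg_comp (c2 p) _; exact: cvg_snd.
  have c221 : continuous (fun p : T => p.2.2.1).
    by move=> p; apply: cvg_comp (c22 p) _; exact: cvg_fst.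
  have c222 : continuous (fun p : T => p.2.2.2).
    by move=> p; apply: cvg_comp (c22 p) _; exact: cvg_snd.
  move=> p; apply: (@cvg_pair _ _ _ (nbhs p) (nbhs (f p).1) (nbhs (f p).2)).
    by apply: cvgD (c21 p); exact: c1.
  apply: (@cvg_pair _ _ _ (nbhs p) (nbhs (f p).2.1) (nbhs (f p).2.2)).
    by apply: cvgD (c221 p); apply: cvgZr_tmp; exact: c1.
  by apply: cvgD (c222 p); apply: cvgMr_tmp; exact: c1.
have fK : compact (f @` (`[0, 1]%classic `*` K)).
  apply: continuous_compact; first exact: continuous_subspaceT.
  by apply: compact_setX => //; exact: segment_compact.
rewrite (_ : [set z | _] = f @` (`[0, 1]%classic `*` K) `&` [set z | z.1 <= 1]).
  apply: compact_closedI fK _.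
  rewrite (_ : [set z | _] = fst @^-1` [set r : R | r <= 1]) //.
  by apply: closed_comp; [move=> ? _; exact: cvg_fst|exact: closed_le].
apply/seteqP; split=> [[t [x h]] /= [t1 [w w0 c]]|].
  have := comb_ge0 c; rewrite subr_ge0 => wt.
  split=> //; exists (w, (t - w, (x - w *: s.1, h - w * s.2))).
    rewrite /= in_itv /= w0 (le_trans wt) //; split=> //.
    by split=> //=; rewrite (le_trans _ t1) // gerBl.
  by rewrite /f /= ![_ + (_ - _)]addrC !subrK.
move=> _ [[[w [t [x h]]] /= [w01 [t1 c]] <-] /= wt1]; split=> //.
by apply: comb_cons => //; move: w01; rewrite /= in_itv => /andP[].
Qed.

(** The largest convex function below the heights [s.2] at the points [s.1]. *)
Definition hullf S x : \bar R := ereal_inf [set h%:E | h in [set h | comb S 1 x h]].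

(** Compactness makes the infimum attained. *)
Lemma hullf_leP S x h : (hullf S x <= h%:E)%E <-> exists2 h', comb S 1 x h' & h' <= h.
Proof.
split=> [Ux|[h' c hh']]; last first.
  apply: (@le_trans _ _ h'%:E); last by rewrite lee_fin.
  by apply: ereal_inf_lbound; exists h'.
pose K : set (R * (E * R)) :=
  [set z : R * (E * R) | z.1 <= 1 /\ comb S z.1 z.2.1 z.2.2] `&`
  ([set z | z.1 = 1] `&` [set z | z.2.1 = x]).
have cK : compact K.
  apply: compact_closedI; first exact: compact_comb.
  apply: closedI.
    rewrite (_ : [set z | _] = fst @^-1` [set 1]) //.
    by apply: closed_comp; [move=> ? _; exact: cvg_fst|exact: closed_eq].
  rewrite (_ : [set z | _] = (fun z : R * (E * R) => z.2.1) @^-1` [set x]) //.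
  apply: closed_comp; last first.
    by apply: compact_closed; [exact: norm_hausdorff|exact: compact_set1].
  by move=> ? _; apply: cvg_comp; [exact: cvg_snd|exact: cvg_fst].
have K0 : K !=set0.
  apply: contrapT => /set0P/negP; rewrite negbK => /eqP K0.
  have : hullf S x = +oo%E; last by move=> UE; move: Ux; rewrite UE.
  rewrite /hullf (_ : [set h | comb S 1 x h] = set0) ?image_set0 ?ereal_inf0 //.
  apply/seteqP; split=> // k ck.
  suff : K (1, (x, k)) by rewrite K0.
  by split.
have fc : {within K, continuous (fun z : R * (E * R) => z.2.2)}.
  apply: continuous_subspaceT => z.
  by apply: cvg_comp; [exact: cvg_snd|exact: cvg_snd].
have [[t [x' h']]] := compact_EVT_min K0 cK fc.
rewrite inE => -[/= [_ c] [/= t1 xx']] hmin; subst t x'.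
exists h' => //; rewrite -lee_fin; apply: le_trans Ux.
apply: le_ereal_inf_tmp => _ [k /= ck <-]; rewrite lee_fin.
by apply: (hmin (1, (x, k))); rewrite inE; split.
Qed.

Lemma hullf_le_comb S x h : comb S 1 x h -> (hullf S x <= h%:E)%E.
Proof. by move=> c; apply/hullf_leP; exists h. Qed.

Lemma hullf_subset S T x : {subset S <= T} -> (hullf T x <= hullf S x)%E.
Proof.
move=> ST; apply: le_ereal_inf_tmp => _ [k /= ck <-].
by apply: hullf_le_comb; apply: comb_subset ck.
Qed.

Lemma hullf_eq_mem S T : S =i T -> hullf S = hullf T.
Proof.
move=> ST; apply/funext => x; apply/eqP; rewrite eq_le !hullf_subset // => s;
  by rewrite ST.
Qed.

Lemma hullf_ge S x (a : R) : (forall h, comb S 1 x h -> a <= h) -> (a%:E <= hullf S x)%E.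
Proof.
by move=> hS; apply: le_ereal_inf_tmp => _ [k /= ck <-]; rewrite lee_fin hS.
Qed.

Lemma hullf_notin S x : (forall h, ~ comb S 1 x h) -> hullf S x = +oo%E.
Proof.
move=> hS; rewrite /hullf (_ : [set h | comb S 1 x h] = set0) ?image_set0 ?ereal_inf0 //.
by apply/seteqP; split=> // k /hS.
Qed.

Lemma hullf_Ny S x : hullf S x != -oo%E.
Proof.
have [K K0 hK] := comb_bounded S.
have : ((- K)%:E <= hullf S x)%E.
  apply: hullf_ge => h /hK[_]; rewrite mulr1 => hh.
  by have := lerNnormlW hh.
by case: (hullf S x).
Qed.

(** Sublevel sets are projections of compact sets, which gives lower semicontinuity. *)
Lemma Conv_sc_hullf S : S != [::] -> Conv_sc (hullf S).
Proof.
move=> S0; apply/Conv_scP; split.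
- exact: hullf_Ny.
- apply/lower_semicontinuousP => a.
  have : closed [set x | (hullf S x <= a%:E)%E].
    pose K : set (R * (E * R)) :=
      [set z : R * (E * R) | z.1 <= 1 /\ comb S z.1 z.2.1 z.2.2] `&`
      ([set z | z.1 = 1] `&` [set z | z.2.2 <= a]).
    have cK : compact K.
      apply: compact_closedI; first exact: compact_comb.
      apply: closedI.
        rewrite (_ : [set z | _] = fst @^-1` [set 1]) //.
        by apply: closed_comp; [move=> ? _; exact: cvg_fst|exact: closed_eq].
      rewrite (_ : [set z | _] = (fun z : R * (E * R) => z.2.2) @^-1` [set r | r <= a]) //.
      apply: closed_comp; last exact: closed_le.
      by move=> ? _; apply: cvg_comp; [exact: cvg_snd|exact: cvg_snd].
    rewrite (_ : [set x | _] = (fun z : R * (E * R) => z.2.1) @` K).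
      apply: compact_closed; first exact: norm_hausdorff.
      apply: continuous_compact => //; apply: continuous_subspaceT => z.
      by apply: cvg_comp; [exact: cvg_snd|exact: cvg_fst].
    apply/seteqP; split=> x /=.
      by move=> /hullf_leP[h' c h'a]; exists (1, (x, h')).
    move=> [[t [x' h']] /= [[/= _ c] [/= t1 h'a]] <-]; subst t.
    by apply/hullf_leP; exists h'.
  move=> /closed_openC; congr open.
  by apply/seteqP; split=> y /=; rewrite ltNge => /negP.
- move=> x y h k t /andP[t0 t1] /hullf_leP[h' ch hh] /hullf_leP[k' ck kk].
  apply/hullf_leP; exists (t * h' + (1 - t) * k').
    have t1' : 0 <= 1 - t by rewrite subr_ge0.
    by apply: (comb_cast (combD (combZ t0 ch) (combZ t1' ck))) => //; ring.
  by rewrite lerD // ler_wpM2l // subr_ge0.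
- case: S S0 => // s S _; exists s.1, s.2; apply: hullf_le_comb.
  by apply: comb_mem1; rewrite mem_head.
move=> A; have [K K0 hK] := comb_bounded S.
exists (`|A| * K + K) => x; apply: hullf_ge => h /hK; rewrite !mulr1 => -[xK hh].
have := lerNnormlW hh; have := ler_wpM2l (normr_ge0 A) xK.
have := ler_wpM2r (normr_ge0 x) (ler_norm A); lra.
Qed.

End Comb.

(** * Cutting, tilting and approximating by hulls *)

Section Transform.
Context {R : realType} {n : nat}.
Local Notation E := 'cV[R]_n.
Implicit Types (x y z : E) (S T A : seq (E * R)) (s : E * R) (t h w : R).
Implicit Types (u v : E -> \bar R).

Definition displace (M : 'M[R]_n) (b : E) s : E * R := (M *m s.1 + b, s.2).

Definition tilt (q : E) (d : R) s : E * R := (s.1, s.2 + (dot q s.1 + d)).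

Lemma comb_displace (M : 'M[R]_n) b S t x h : comb S t x h ->
  comb (map (displace M b) S) t (M *m x + t *: b) h.
Proof.
elim: S t x h => [|s S IH] t x h /=.
  by case=> -> -> ->; rewrite mulmx0 scale0r addr0.
case=> w w0 c; exists w => //=; apply: (comb_cast (IH _ _ _ c)) => //.
by rewrite mulmxBr -scalemxAr scalerDr opprD scalerBl addrACA.
Qed.

Lemma comb_tilt q d S t x h : comb S t x h ->
  comb (map (tilt q d) S) t x (h + (dot q x + t * d)).
Proof.
elim: S t x h => [|s S IH] t x h /=.
  by case=> -> -> ->; rewrite dot0r mul0r !addr0.
case=> w w0 c; exists w => //=; apply: (comb_cast (IH _ _ _ c)) => //.
by rewrite dotBr dotZr; ring.
Qed.

Lemma hullf_displace (M : 'M[R]_n) b S x : M \in unitmx ->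
  hullf (map (displace M b) S) x = hullf S (invmx M *m (x - b)).
Proof.
move=> Mu; apply: eq_sublevel => h; split=> /hullf_leP[h' c hh]; apply/hullf_leP;
  exists h' => //.
  have := comb_displace (invmx M) (- (invmx M *m b)) c.
  rewrite -map_comp (eq_map (g := id)) => [|s].
    by rewrite map_id scale1r mulmxBr.
  by rewrite /displace /= mulmxDr mulKmx // addrK -surjective_pairing.
have := comb_displace M b c.
by rewrite mulKVmx // scale1r subrK.
Qed.

Lemma hullf_tilt q d S x :
  hullf (map (tilt q d) S) x = (hullf S x + (dot q x + d)%:E)%E.
Proof.
apply: eq_sublevel => h; rewrite lee_addc; split=> /hullf_leP[h' c hh]; apply/hullf_leP.
  have := comb_tilt (- q) (- d) c.
  rewrite -map_comp (eq_map (g := id)) => [|s]; last first.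
    by rewrite /tilt /= dotNl -opprD addrK -surjective_pairing.
  by rewrite map_id => c'; exists (h' + (dot (- q) x + 1 * - d)); rewrite // dotNl; lra.
by exists (h' + (dot q x + 1 * d)); [exact: comb_tilt|lra].
Qed.

Definition mid l s1 s2 : E * R :=
  (l *: s1.1 + (1 - l) *: s2.1, l * s1.2 + (1 - l) * s2.2).

Lemma mid_comb l s1 s2 S : 0 <= l <= 1 ->
  comb (s1 :: s2 :: S) 1 (mid l s1 s2).1 (mid l s1 s2).2.
Proof.
move=> /andP[l0 l1]; exists l => //; exists (1 - l); first by rewrite subr_ge0.
apply: (comb_cast (comb0 S)); rewrite ?subrr //.
  by rewrite addrAC addrK subrr.
by rewrite addrAC addrK subrr.
Qed.

Lemma comb_redundant s S t x h : (exists2 h', comb S 1 s.1 h' & h' <= s.2) ->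
  comb (s :: S) t x h -> exists2 h', comb S t x h' & h' <= h.
Proof.
move=> [h' c hh'] [w w0 cw]; exists (w * h' + (h - w * s.2)).
  apply: (comb_cast (combD (combZ w0 c) cw)) => //; first by ring.
  by rewrite addrC subrK.
by have := ler_wpM2l w0 hh'; lra.
Qed.

Lemma hullf_redundant s S : (exists2 h', comb S 1 s.1 h' & h' <= s.2) ->
  hullf (s :: S) = hullf S.
Proof.
move=> rs; apply/funext => x; apply: eq_sublevel => h; split=> /hullf_leP[h' c hh].
  have [k ck kh] := comb_redundant rs c.
  by apply/hullf_leP; exists k; rewrite // (le_trans kh).
by apply/hullf_leP; exists h' => //; apply: comb_tail.
Qed.

(** The comparison of the two weights tells on which side of the cutting hyperplane
    the combination lies. *)
Lemma comb_split l s1 s2 S t x h : 0 < l < 1 -> comb (s1 :: s2 :: S) t x h ->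
  comb (mid l s1 s2 :: s2 :: S) t x h \/ comb (s1 :: mid l s1 s2 :: S) t x h.
Proof.
move=> /andP[l0 l1] [a a0 [b b0 c]].
have l1' : 0 < 1 - l by rewrite subr_gt0.
have [ab|ab] := leP (b * l) (a * (1 - l)); [right|left].
  exists (a - b / (1 - l) * l).
    by rewrite subr_ge0 mulrAC ler_pdivrMr.
  exists (b / (1 - l)); first by rewrite divr_ge0 // ltW.
  have l1n : 1 - l != 0 by rewrite gt_eqF.
  apply: (comb_cast c); [by field| |by rewrite /=; field].
  by apply/matrixP => i j; rewrite !mxE; field.
exists (a / l); first by rewrite divr_ge0 // ltW.
exists (b - a / l * (1 - l)).
  by rewrite subr_ge0 mulrAC ler_pdivrMr // ltW.
have ln : l != 0 by rewrite gt_eqF.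
apply: (comb_cast c); [by field| |by rewrite /=; field].
by apply/matrixP => i j; rewrite !mxE; field.
Qed.

(** A point with one representation avoiding [s1] and another avoiding [s2] is
    a mixture of both in which [s1] and [s2] merge into the point [mid l s1 s2]. *)
Lemma comb_cap l s1 s2 S t x h1 h2 h : 0 < l < 1 -> h1 <= h -> h2 <= h ->
  comb (mid l s1 s2 :: s2 :: S) t x h1 -> comb (s1 :: mid l s1 s2 :: S) t x h2 ->
  exists2 h', comb (mid l s1 s2 :: S) t x h' & h' <= h.
Proof.
move=> /andP[l0 l1] h1h h2h [m m0 [b b0 c1]] [a a0 [k k0 c2]].
have l1' : 0 < 1 - l by rewrite subr_gt0.
have [D0|D0] := eqVneq (a * (1 - l) + b * l) 0.
  have b00 : b = 0.
    have := mulr_ge0 a0 (ltW l1'); have := mulr_ge0 b0 (ltW l0) => bl al.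
    have : b * l = 0 by lra.
    by move/eqP; rewrite mulf_eq0 (gt_eqF l0) orbF => /eqP.
  exists h1 => //; exists m => //; apply: (comb_cast c1).
  - by rewrite b00 subr0.
  - by rewrite b00 scale0r subr0.
  - by rewrite b00 mul0r subr0.
have Dp : 0 < a * (1 - l) + b * l.
  by rewrite lt_neqAle eq_sym D0 addr_ge0 // mulr_ge0 // ltW.
set D := _ + _ in D0 Dp.
(* in the mixture [s1] and [s2] get weights proportional to [l] and [1 - l] *)
pose p := a * (1 - l) / D; pose q := b * l / D.
have p0 : 0 <= p by rewrite divr_ge0 ?mulr_ge0 // ltW.
have q0 : 0 <= q by rewrite divr_ge0 ?mulr_ge0 // ltW.
have pq : p + q = 1 by rewrite -mulrDl divff.
exists (p * h1 + q * h2); last first.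
  have := ler_wpM2l p0 h1h; have := ler_wpM2l q0 h2h.
  have : p * h + q * h = h by rewrite -mulrDl pq mul1r.
  by lra.
exists (p * m + q * k + a * b / D).
  apply: addr_ge0; first by apply: addr_ge0; exact: mulr_ge0.
  by apply: divr_ge0; [exact: mulr_ge0|exact: ltW].
apply: (comb_cast (combD (combZ p0 c1) (combZ q0 c2))).
- rewrite [in RHS](_ : t = p * t + q * t); last by rewrite -mulrDl pq mul1r.
  by rewrite /p /q; field.
- apply/matrixP => i j; rewrite !mxE.
  rewrite [in RHS](_ : x i j = p * x i j + q * x i j); last by rewrite -mulrDl pq mul1r.
  by rewrite /p /q; field.
by rewrite /= /p /q; field.
Qed.

Lemma mid_redundant l s1 s2 S : 0 < l < 1 ->
  hullf (mid l s1 s2 :: s1 :: s2 :: S) = hullf (s1 :: s2 :: S).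
Proof.
move=> /andP[l0 l1]; apply: hullf_redundant; exists (mid l s1 s2).2 => //.
by apply: mid_comb; rewrite !ltW.
Qed.

(** Cutting the hull along the hyperplane through [S] and an interior point of the
    edge from [s1] to [s2]: the union of the two halves is the whole. *)
Lemma hullf_split_min l s1 s2 S : 0 < l < 1 -> hullf (s1 :: s2 :: S) =
  fun x => Order.min (hullf (mid l s1 s2 :: s2 :: S) x) (hullf (s1 :: mid l s1 s2 :: S) x).
Proof.
move=> l01; apply/funext => x; apply: eq_sublevel => h.
rewrite ge_min; split=> [/hullf_leP[h' c hh]|].
  apply/orP; case: (comb_split l01 c) => {}c; [left|right];
    by apply/hullf_leP; exists h'.
rewrite -(mid_redundant s1 s2 S l01).
case/orP; apply: le_trans; apply: hullf_subset => s; rewrite !inE => /or3P[] ->;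
  by rewrite ?orbT.
Qed.

(** The intersection of the two halves is the hull of the cutting points. *)
Lemma hullf_split_max l s1 s2 S : 0 < l < 1 -> hullf (mid l s1 s2 :: S) =
  fun x => Order.max (hullf (mid l s1 s2 :: s2 :: S) x) (hullf (s1 :: mid l s1 s2 :: S) x).
Proof.
move=> l01; apply/funext => x; apply: eq_sublevel => h.
rewrite ge_max; split=> [Ux|/andP[/hullf_leP[h1 c1 hh1] /hullf_leP[h2 c2 hh2]]].
  apply/andP; split; apply: le_trans Ux; apply: hullf_subset => s;
    by rewrite !inE => /orP[] ->; rewrite ?orbT.
by apply/hullf_leP; apply: comb_cap c1 c2.
Qed.

(** The limit is approached from below by semicontinuous functions, so the
    inferior limit condition needs only one of them and recovery sequences are
    constant. *)
Lemma epi_cvg_nondecreasing (u_ : nat -> E -> \bar R) u :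
  (forall x, u x != -oo%E) -> (forall k, lower_semicontinuous (u_ k)) ->
  (forall j k x, (j <= k)%N -> (u_ j x <= u_ k x)%E) ->
  (forall k x, (u_ k x <= u x)%E) ->
  (forall x a, (a%:E < u x)%E -> exists k, (a%:E < u_ k x)%E) ->
  epi_cvg u_ u.
Proof.
move=> uN lu mono le_u sup_u; apply: epi_cvgI => // [x x_ a cx /sup_u[j aj]|x h uh].
  have : \forall k \near \oo, (a%:E < u_ j (x_ k))%E.
    exact: (cx [set y | (a%:E < u_ j y)%E] (lsc_near (lu j) aj)).
  have : \forall k \near \oo, (j <= k)%N by exact: nbhs_infty_ge.
  apply: filterS2 => k jk /ltW ak; exact: le_trans ak (mono _ _ _ jk).
exists (fun=> x); split=> [|e e0]; first exact: cvg_cst.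
apply: nearW => k; apply: le_trans (le_u k x) _; apply: le_trans uh _.
by rewrite lee_fin lerDl ltW.
Qed.

(** A sum of nonnegative terms vanishes only if each term does. *)
Lemma comb_face q b S t x h : (forall s, s \in S -> 0 <= dot q s.1 + b) ->
  comb S t x h -> dot q x + t * b = 0 ->
  comb [seq s <- S | dot q s.1 + b == 0] t x h.
Proof.
elim: S t x h => [|s S IH] t x h pos //=.
have posS s' : s' \in S -> 0 <= dot q s'.1 + b.
  by move=> sS; apply: pos; rewrite inE sS orbT.
case=> w w0 c qx.
have ge0 : 0 <= dot q (x - w *: s.1) + (t - w) * b.
  apply: (@comb_linear _ _ (fun x h t => dot q x + t * b) S _ _ _ _ _ _ c).
  - by move=> *; rewrite dotDr mulrDl addrACA.
  - by move=> *; rewrite dotZr mulrDr mulrA.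
  - by move=> s' /posS; rewrite mul1r.
have sp := pos s (mem_head _ _); have wsp := mulr_ge0 w0 sp.
have E1 : w * (dot q s.1 + b) + (dot q (x - w *: s.1) + (t - w) * b) = 0.
  by rewrite dotBr dotZr -qx; ring.
have [w1 E2] : w * (dot q s.1 + b) = 0 /\ dot q (x - w *: s.1) + (t - w) * b = 0.
  by split; lra.
have c' := IH _ _ _ posS c E2.
case: eqVneq => [_|ns]; first by exists w.
move/eqP: w1; rewrite mulf_eq0 (negbTE ns) orbF => /eqP w0'.
by apply: (comb_cast c'); rewrite w0' ?scale0r ?mul0r subr0.
Qed.

(** Tilting by ever larger multiples of an affine function nonnegative on [S] drives
    the hull, increasingly, to its face where that function vanishes. *)
Lemma epi_cvg_face q b S : S != [::] -> (forall s, s \in S -> 0 <= dot q s.1 + b) ->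
  epi_cvg (fun k => hullf (map (tilt (k%:R *: q) (k%:R * b)) S))
          (hullf [seq s <- S | dot q s.1 + b == 0]).
Proof.
move=> Sn pos; set S0 := [seq s <- S | _].
have UE k x : hullf (map (tilt (k%:R *: q) (k%:R * b)) S) x =
    (hullf S x + (k%:R * (dot q x + b))%:E)%E.
  by rewrite hullf_tilt dotZl mulrDr.
have beta_ge0 x h : comb S 1 x h -> 0 <= dot q x + b.
  move=> c; rewrite -[b]mul1r.
  apply: (@comb_linear _ _ (fun x h t => dot q x + t * b) S _ _ _ _ _ _ c).
  - by move=> *; rewrite dotDr mulrDl addrACA.
  - by move=> *; rewrite dotZr mulrDr mulrA.
  - by move=> s' /pos; rewrite mul1r.
apply: epi_cvg_nondecreasing; first exact: hullf_Ny.
- move=> k; have : Conv_sc (hullf (map (tilt (k%:R *: q) (k%:R * b)) S)).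
    by apply: Conv_sc_hullf; case: (S) Sn.
  by case.
- move=> j k x jk; rewrite !UE; apply: lee_realP => a; rewrite !ltNge => aj.
  rewrite leNgt; apply: contra aj; rewrite !lee_addc => /ltW.
  rewrite lee_addc => /hullf_leP[h c ha]; apply/hullf_leP; exists h => //.
  apply: le_trans ha _; rewrite lerD2l lerN2.
  by rewrite ler_wpM2r ?ler_nat // (beta_ge0 _ _ c).
- move=> k x; apply: lee_realP => a; rewrite ltNge => aj.
  rewrite leNgt; apply: contra aj => /ltW/hullf_leP[h c ha]; apply/hullf_leP; exists h => //.
  apply: comb_subset c => s; rewrite mem_filter => /andP[/eqP s0 sS].
  apply/mapP; exists s => //; rewrite /tilt dotZl -mulrDr s0 mulr0 addr0.
  exact: surjective_pairing.
move=> x a ax; apply: contrapT => /forallNP na.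
have ka k : exists2 h, comb S 1 x h & h <= a - k%:R * (dot q x + b).
  by apply/hullf_leP; rewrite -lee_addc -UE leNgt; apply/negP/na.
have [h0 c0 ha0] := ka 0%N.
have [b0|bn] := eqVneq (dot q x + b) 0.
  move: ax; rewrite ltNge => /negP; apply; apply/hullf_leP; exists h0.
    by apply: comb_face => //; rewrite mul1r.
  by move: ha0; rewrite mul0r subr0.
have bp : 0 < dot q x + b by rewrite lt_neqAle eq_sym bn (beta_ge0 _ _ c0).
have [K K0 hK] := comb_bounded S.
pose k := Num.bound `|(a + K) / (dot q x + b)|.
have [h c ha] := ka k.
have [_] := hK _ _ _ c; rewrite mulr1 => /lerNnormlW hh.
have : (a + K) / (dot q x + b) < k%:R.
  by apply: le_lt_trans (ler_norm _) _; apply: archi_boundP; rewrite normr_ge0.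
rewrite ltr_pdivrMr //; lra.
Qed.

Lemma epi_cvg_uniform (u_ : nat -> E -> \bar R) u (e_ : nat -> R) :
  Conv_sc u -> e_ @ \oo --> 0 ->
  (forall k x, (u_ k x <= u x + (e_ k)%:E)%E) ->
  (forall k x, (u x <= u_ k x + (e_ k)%:E)%E) ->
  epi_cvg u_ u.
Proof.
move=> [uN lu _ _ _] e0 le_u ge_u; apply: epi_cvgI => // [x x_ a cx ax|x h uh].
  have [a' [aa' a'u]] : exists a' : R, a < a' /\ (a'%:E < u x)%E.
    case: (u x) ax => [r| |//]; last by exists (a + 1); rewrite ltrDl ltr01 ltry.
    by rewrite lte_fin => ar; exists ((a + r) / 2); rewrite lte_fin; split; lra.
  have h1 : \forall k \near \oo, (a'%:E < u (x_ k))%E.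
    exact: (cx [set y | (a'%:E < u y)%E] (lsc_near lu a'u)).
  have h2 : \forall k \near \oo, e_ k < a' - a.
    by apply: (cvgr_lt _ e0); rewrite subr_gt0.
  move: h1 h2; apply: filterS2 => k /lt_le_trans/(_ (ge_u k (x_ k))) /ltW.
  by rewrite lee_caddr => h1 h2; apply: le_trans h1; rewrite lee_fin; lra.
exists (fun=> x); split=> [|e ep]; first exact: cvg_cst.
have : \forall k \near \oo, e_ k < e by apply: (cvgr_lt _ e0).
apply: filterS => k ke; apply: le_trans (le_u k x) _.
rewrite lee_addc; apply: le_trans uh _; rewrite lee_fin; lra.
Qed.

Lemma comb_heights (I : eqType) (r : seq I) (a : I -> E) (c c' : I -> R) d t x h :
  (forall i, i \in r -> c' i <= c i + d) ->
  comb [seq (a i, c i) | i <- r] t x h ->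
  exists2 h', comb [seq (a i, c' i) | i <- r] t x h' & h' <= h + t * d.
Proof.
elim: r t x h => [|i r IH] t x h cc /=.
  by case=> -> -> ->; exists 0; rewrite // mul0r addr0.
case=> w w0 /IH[|h' ch hh].
  by move=> j jr; apply: cc; rewrite inE jr orbT.
exists (w * c' i + h').
  exists w => //; apply: (comb_cast ch) => //=; first by rewrite addrAC subrr add0r.
have := ler_wpM2l w0 (cc i (mem_head _ _)); lra.
Qed.

Lemma hullf_heights (I : eqType) (r : seq I) (a : I -> E) (c c' : I -> R) d x :
  (forall i, i \in r -> c' i <= c i + d) ->
  (hullf [seq (a i, c' i) | i <- r] x <= hullf [seq (a i, c i) | i <- r] x + d%:E)%E.
Proof.
move=> cc; apply: lee_realP => e; rewrite ltNge => ae.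
rewrite leNgt; apply: contra ae => /ltW; rewrite lee_addc => /hullf_leP[h ch hd].
have [h' ch' hh'] := comb_heights cc ch; apply/hullf_leP; exists h' => //.
by rewrite mul1r in hh'; lra.
Qed.

(** Induction on [S] needs combinations of arbitrary positive weight, rescaled to
    weight [1]. *)
Lemma le_hullf u S : epi_convex u -> (forall s, s \in S -> (u s.1 <= s.2%:E)%E) ->
  forall x, (u x <= hullf S x)%E.
Proof.
move=> cu uS x.
suff H t z h : comb S t z h -> 0 < t -> (u (t^-1 *: z) <= (t^-1 * h)%:E)%E.
  apply: lee_realP => a ax; apply: ltW; apply: lt_le_trans ax _.
  apply: le_ereal_inf_tmp => _ [h /= ch <-].
  by have := H _ _ _ ch ltr01; rewrite invr1 scale1r mul1r.
elim: S uS t z h => [|s S IH] uS t z h /=.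
  by case=> -> _ _; rewrite ltxx.
have {}IH := IH (fun a aS => uS a (mem_behead (s := s :: S) aS)).
have us := uS s (mem_head _ _).
case=> w w0 c t0; have := comb_ge0 c; rewrite subr_ge0 le_eqVlt => /orP[/eqP wt|wt].
  move: c; rewrite wt subrr => /comb_t0[/eqP + /eqP].
  rewrite !subr_eq0 => /eqP -> /eqP ->.
  by rewrite scalerA mulrA mulVf ?gt_eqF // scale1r mul1r.
have tw : 0 < t - w by rewrite subr_gt0.
have wt01 : 0 <= w / t <= 1.
  by rewrite divr_ge0 //= ?ler_pdivrMr ?mul1r // ltW.
have := cu _ _ _ _ _ wt01 us (IH _ _ _ c tw).
have tn : t != 0 by rewrite gt_eqF.
have twn : t - w != 0 by rewrite gt_eqF.
rewrite (_ : _ + _ = t^-1 *: z); last first.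
  by apply/matrixP => i j; rewrite !mxE; field; rewrite tn twn.
rewrite (_ : w / t * s.2 + _ = t^-1 * h) //.
by field; rewrite tn twn.
Qed.

Lemma finite_net (T : normedModType R) (K : set T) (e : R) :
  compact K -> 0 < e -> exists s : seq T,
    forall p : T, K p -> exists2 p', p' \in s & ball p' e p.
Proof.
move=> + e0; rewrite (@compact_cover T) => cK.
have [||D _ KD] := cK T setT (fun p => (ball p e)°).
- by move=> i _; exact: open_interior.
- move=> x Kx; exists x => //; rewrite /interior /=.
  by apply: nbhsx_ballx.
exists (finmap.enum_fset D) => x /KD[p /= pD px]; exists p => //.
exact: interior_subset px.
Qed.

(** The hulls of finite nets of the epigraph, finer and finer on larger and larger
    balls: they lie above [u], which is lower semicontinuous, and the net points
    provide recovery sequences. *)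
Lemma approx_hull u : Conv_sc u -> exists S_ : nat -> seq (E * R),
  (forall k, S_ k != [::]) /\ epi_cvg (fun k => hullf (S_ k)) u.
Proof.
move=> /Conv_scP[uN lu cu [x0 [h0 u0]] su].
pose epi (z : E * R) := (u z.1 <= z.2%:E)%E.
have net k : exists S : seq (E * R), [/\ S != [::], forall s, s \in S -> epi s &
    forall z : E * R, epi z -> `|z.1| <= k%:R -> `|z.2| <= k%:R -> exists2 s, s \in S &
      ball s (2 * k.+1%:R^-1) z].
  have e0 : 0 < k.+1%:R^-1 :> R by rewrite invr_gt0.
  have cK : compact ([set x : E | `|x - 0| <= k%:R] `*` (`[- k%:R, k%:R]%classic : set R)).
    by apply: compact_setX; [exact: compact_cball|exact: segment_compact].
  have [r hr] := finite_net cK e0.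
  pose pick (p : E * R) : E * R :=
    if pselect (exists z : E * R, epi z /\ ball p k.+1%:R^-1 z) is left ex
    then sval (cid ex) else (x0, h0).
  exists ((x0, h0) :: map pick r); split=> //.
    move=> s; rewrite inE => /orP[/eqP -> //|/mapP[p _ ->]].
    by rewrite /pick; case: pselect => // ex; have [] := svalP (cid ex).
  move=> z ez z1 z2; have [|p pr pz] := hr z.
    by split; rewrite /= ?subr0 // in_itv /= -ler_norml.
  exists (pick p); first by rewrite inE map_f ?orbT.
  rewrite /pick; case: pselect => [ex|[]]; last by exists z.
  have [_ pz'] := svalP (cid ex).
  rewrite (_ : 2 * _ = k.+1%:R^-1 + k.+1%:R^-1); last by ring.
  by apply: ball_triangle pz; apply: ball_sym.
have [S_ hS] := choice net; exists S_; split=> [k|]; first by have [] := hS k.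
have leU k x : (u x <= hullf (S_ k) x)%E by apply: le_hullf => // s; have [_ /(_ s)] := hS k.
apply: epi_cvgI => // [x x_ a cx ax|x h uh].
  have : \forall k \near \oo, (a%:E < u (x_ k))%E.
    exact: (cx [set y | (a%:E < u y)%E] (lsc_near lu ax)).
  by apply: filterS => k /ltW ak; apply: le_trans ak (leU _ _).
have sel k : exists s, `|x| <= k%:R -> `|h| <= k%:R ->
    s \in S_ k /\ ball s (2 * k.+1%:R^-1) (x, h).
  have [_ _ /(_ (x, h) uh)] := hS k.
  case: (leP `|x| k%:R) => [xk|_ _]; last by exists (x, h).
  case: (leP `|h| k%:R) => [hk|_ _]; last by exists (x, h).
  by move=> /(_ isT isT)[s sS bs]; exists s.
have [s_ hs] := choice sel.
have near_s : \forall k \near \oo, s_ k \in S_ k /\ ball (s_ k) (2 * k.+1%:R^-1) (x, h).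
  have : \forall k \near \oo, `|x| <= k%:R :> R by exact: nbhs_infty_ger.
  have : \forall k \near \oo, `|h| <= k%:R :> R by exact: nbhs_infty_ger.
  by apply: filterS2 => k hk xk; exact: hs.
have near_e e : 0 < e -> \forall k \near \oo, 2 * k.+1%:R^-1 < e :> R.
  move=> e0; have e2 : 0 < e / 2 by rewrite divr_gt0.
  have := near_infty_natSinv_lt (PosNum e2); apply: filterS => k /=.
  by rewrite ltr_pdivlMr // mulrC.
exists (fun k => (s_ k).1); split.
  apply/cvgrPdist_lt => e e0; move: near_s (near_e e e0).
  apply: filterS2 => k [_ [+ _]] ke; rewrite -ball_normE /= distrC => /lt_trans.
  exact.
move=> e e0; move: near_s (near_e e e0).
apply: filterS2 => k [sS [_ +]] ke; rewrite -ball_normE /= => bk.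
apply: le_trans (hullf_le_comb (comb_mem1 sS)) _; rewrite lee_fin.
by move: (lt_trans bk ke); rewrite ltr_distlC ltrBlDr => /andP[/ltW].
Qed.

End Transform.

(** * Continuous functionals blind to affine summands; dilations in SL(n) *)

Section Functionals.
Context {R : realType} {n : nat}.
Local Notation E := 'cV[R]_n.
Implicit Types (x y z : E) (S T A : seq (E * R)) (s : E * R) (t h w : R).
Implicit Types (u v : E -> \bar R) (Y : (E -> \bar R) -> R).

Definition epi_cont Y := forall (u_ : nat -> E -> \bar R) u,
  (forall i, Conv_sc (u_ i)) -> Conv_sc u -> epi_cvg u_ u -> Y \o u_ @ \oo --> Y u.

Lemma seq_argmin (T : eqType) (f : T -> R) (r : seq T) : r != [::] ->
  exists2 i, i \in r & forall j, j \in r -> f i <= f j.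
Proof.
elim: r => [|i r IH] // _; have [->|/IH[k kr hk]] := eqVneq r [::].
  by exists i; rewrite ?mem_head // => j; rewrite inE => /eqP ->.
have [ik|/ltW ki] := leP (f i) (f k).
  exists i; rewrite ?mem_head // => j; rewrite inE => /orP[/eqP -> //|/hk].
  exact: le_trans.
by exists k; rewrite ?inE ?kr ?orbT // => j /orP[/eqP -> //|/hk].
Qed.

Lemma epi_cont_hulls Y (c : R) : epi_cont Y ->
  (forall S, S != [::] -> Y (hullf S) = c) -> forall u, Conv_sc u -> Y u = c.
Proof.
move=> Yc YS u cu; have [S_ [Sn su]] := approx_hull cu.
have := Yc _ _ (fun k => Conv_sc_hullf (Sn k)) cu su.
rewrite (_ : Y \o _ = fun=> c); last by apply/funext => k /=; rewrite YS.
by move/(cvg_unique _ (@cvg_cst _ c _ _ _)) => <-.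
Qed.

(** Steep tilts collapse a hull to a face of its domain.  Two points over different
    base points are separated by the linear function along their difference, so
    the collapse can be repeated until one base point is left; the two ends of a
    segment show that the remaining base point is irrelevant. *)
Lemma affine_invariant_cst Y : epi_cont Y ->
  (forall u q d, Conv_sc u -> Y (fun x => (u x + (dot q x + d)%:E)%E) = Y u) ->
  forall u, Conv_sc u -> Y u = Y (hullf [:: (0, 0)]).
Proof.
move=> Yc Ya.
have tiltE q d S : S != [::] -> Y (hullf (map (tilt q d) S)) = Y (hullf S).
  move=> Sn; rewrite -(Ya _ q d (Conv_sc_hullf Sn)); congr Y.
  by apply/funext => x; rewrite hullf_tilt.
have face q b S : S != [::] -> (forall s, s \in S -> 0 <= dot q s.1 + b) ->
    [seq s <- S | dot q s.1 + b == 0] != [::] ->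
    Y (hullf S) = Y (hullf [seq s <- S | dot q s.1 + b == 0]).
  move=> Sn pos Fn; have cT k : Conv_sc (hullf (map (tilt (k%:R *: q) (k%:R * b)) S)).
    by apply: Conv_sc_hullf; case: (S) Sn.
  have := Yc _ _ cT (Conv_sc_hullf Fn) (epi_cvg_face Sn pos).
  rewrite (_ : Y \o _ = fun=> Y (hullf S)); last by apply/funext => k /=; rewrite tiltE.
  by move/(cvg_unique _ (@cvg_cst _ _ _ _ _)) => ->.
have point y h : Y (hullf [:: (y, h)]) = Y (hullf [:: (0, 0)]).
  have -> : [:: (y, h)] = map (tilt 0 h) [:: (y, 0)].
    by rewrite /= /tilt dot0l !add0r.
  rewrite tiltE //; have [->//|y0] := eqVneq y 0.
  have yy := dot_self_gt0 y0.
  have f0 : Y (hullf [:: (0, 0); (y, 0)]) = Y (hullf [:: (0, 0)]).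
    rewrite (face y 0) //=; rewrite ?dot0r ?addr0 ?eqxx ?gt_eqF //.
    by move=> s; rewrite !inE => /orP[] /eqP -> /=; rewrite addr0 ?dot0r // ltW.
  rewrite -f0 [RHS](face (- y) (dot y y)) //=;
    rewrite ?dot0r ?add0r ?dotNl ?addNr ?eqxx ?gt_eqF //.
  move=> s; rewrite !inE => /orP[] /eqP -> /=; first by rewrite dot0r add0r ltW.
  by rewrite dotNl addNr.
apply: (epi_cont_hulls Yc) => S.
have [m] := ubnP (size S); elim: m S => // m IH [|s1 [|s2 S]] // sm _.
  by rewrite {1}(surjective_pairing s1) point.
have [s12|s12] := eqVneq s1.1 s2.1.
  wlog h12 : s1 s2 sm s12 / s2.2 <= s1.2 => [hw|].
    have [|/ltW] := leP s2.2 s1.2; first exact: hw.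
    move=> h12; rewrite -(hw s2 s1) //; congr Y; apply: hullf_eq_mem => s.
    by rewrite !inE orbCA.
  rewrite hullf_redundant; first by apply: IH.
  by exists s2.2; rewrite // s12; apply: comb_mem1; rewrite mem_head.
(* [q] takes different values at [s1] and [s2], so its minimal face omits one of them *)
pose q := s1.1 - s2.1.
have [s0 s0S hs0] := @seq_argmin _ (fun s => dot q s.1) (s1 :: s2 :: S) isT.
have F0 : s0 \in [seq s <- s1 :: s2 :: S | dot q s.1 - dot q s0.1 == 0].
  by rewrite mem_filter subrr eqxx.
have Fn : [seq s <- s1 :: s2 :: S | dot q s.1 - dot q s0.1 == 0] != [::].
  by apply: contraTneq F0 => ->.
rewrite (face q (- dot q s0.1)) // => [|s /hs0]; last by rewrite subr_ge0.
apply: IH => //; rewrite size_filter -ltnS; apply: leq_trans sm.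
rewrite -(count_predC (fun s => dot q s.1 - dot q s0.1 == 0) (s1 :: s2 :: S)).
rewrite -addn1 leq_add2l -has_count.
apply/hasP; have [h1|h1] := eqVneq (dot q s1.1 - dot q s0.1) 0; last first.
  by exists s1; rewrite ?mem_head.
exists s2; first by rewrite !inE eqxx orbT.
apply/eqP => h2; have : dot q q = 0 by rewrite {2}/q dotBr; move: h1 h2 => /=; lra.
by move/eqP; rewrite dot_self_eq0 subr_eq0 (negbTE s12).
Qed.

(** Contracting the base points to the origin leaves only the lowest height. *)
Lemma epi_cvg_shrink S s0 : s0 \in S -> (forall s, s \in S -> s0.2 <= s.2) ->
  epi_cvg (fun k => hullf (map (displace (k.+1%:R^-1)%:M 0) S)) (hullf [:: (0, s0.2)]).
Proof.
move=> s0S hs0; have [K K0 hK] := comb_bounded S.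
have kn k : k.+1%:R != 0 :> R by rewrite pnatr_eq0.
have UE k x : hullf (map (displace (k.+1%:R^-1)%:M 0) S) x = hullf S (k.+1%:R *: x).
  rewrite hullf_displace; last by rewrite unitmxE det_scalar unitfE expf_neq0 // invr_eq0.
  by rewrite subr0 invmx_scalar invrK mul_scalar_mx.
have minU x : (s0.2%:E <= hullf S x)%E.
  apply: hullf_ge => h c; rewrite -subr_ge0.
  have /= := @comb_linear _ _ (fun (x : E) h t => h - s0.2 * t) S 1 x h _ _ _ c.
  rewrite mulr1; apply; [by move=> *; ring|by move=> *; ring|].
  by move=> s /hs0; rewrite subr_ge0.
apply: epi_cvgI => [|x x_ a cx ax|x h /hullf_leP[h' [w w0 /= [w1 x0 hc]] hh]].
- exact: hullf_Ny.
- have [x0|x0] := eqVneq x 0.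
    apply: nearW => k; rewrite UE; apply: le_trans (minU _); apply: ltW.
    apply: lt_le_trans ax _; apply: hullf_le_comb; rewrite x0.
    exact: (@comb_mem1 _ _ [:: (0, s0.2)] (0, s0.2) (mem_head _ _)).
  have x2 : 0 < `|x| / 2 by rewrite divr_gt0 // normr_gt0.
  have : \forall k \near \oo, `|x - x_ k| < `|x| / 2 by apply: cvgr_dist_lt.
  have : \forall k \near \oo, K / (`|x| / 2) <= k%:R by exact: nbhs_infty_ger.
  apply: filterS2 => k kK xk; rewrite UE hullf_notin ?leey // => h c.
  have [+ _] := hK _ _ _ c; rewrite mulr1 normrZ ger0_norm // leNgt => /negP; apply.
  rewrite ler_pdivrMr // in kK; apply: le_lt_trans kK _.
  apply: (@lt_le_trans _ _ (k.+1%:R * (`|x| / 2))).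
    by rewrite ltr_pM2r // ltr_nat.
  rewrite ler_wpM2l //.
  have : `|x| <= `|x - x_ k| + `|x_ k|.
    by rewrite -{1}(subrK (x_ k) x) ler_normD.
  by move: xk; lra.
exists (fun k => k.+1%:R^-1 *: s0.1); split.
  have -> : x = 0 *: s0.1.
    by move/eqP: x0; rewrite scaler0 subr0 scale0r => /eqP.
  by apply: cvgZr_tmp; exact: cvg_harmonic.
move=> e e0; apply: nearW => k; rewrite UE scalerA divff // scale1r.
apply: le_trans (hullf_le_comb (comb_mem1 s0S)) _; rewrite lee_fin.
have w1' : w = 1 by apply/eqP; rewrite eq_sym -subr_eq0 w1.
by move/eqP: hc; rewrite w1' mul1r subr_eq0 => /eqP <-; lra.
Qed.

(** From the rank factorization of the row [x^T]: its left factor is a multiple of the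
    first unit row. *)
Lemma basis_extension m (x : 'cV[R]_m.+1) : x != 0 ->
  exists2 B : 'M[R]_m.+1, B \in unitmx & B *m delta_mx 0 0 = x.
Proof.
move=> x0; pose p : 'rV[R]_m.+1 := col_ebase x^T *m pid_mx (\rank x^T).
have xE : p *m row_ebase x^T = x^T := mulmx_ebase x^T.
have := row_ebase_unit x^T; move: (row_ebase x^T) xE => C xE Cu.
have pj j : j != 0 -> p 0 j = 0.
  move=> j0; rewrite mxE big_ord1 mxE eq_sym (_ : (_ == _) = false) ?mulr0 //.
  by apply/eqP => j0'; case/eqP: j0; apply: val_inj.
clearbody p; have pE : p = p 0 0 *: delta_mx 0 0.
  apply/matrixP => i j; rewrite ord1 !mxE eqxx andTb.
  by have [->|/pj ->] := eqVneq j 0; rewrite ?mulr1 ?mulr0.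
have p0 : p 0 0 != 0.
  apply: contraNneq x0 => p0; apply/eqP/trmx_inj.
  by rewrite trmx0 -xE pE p0 scale0r mul0mx.
exists (p 0 0 *: C^T); first by rewrite unitmxZ ?unitfE // unitmx_tr.
apply: trmx_inj; rewrite trmx_mul trmx_delta linearZ /= trmxK -xE [in RHS]pE.
by rewrite -scalemxAl -scalemxAr.
Qed.

(** The direction off the hyperplane absorbs the determinant. *)
Lemma SL_dilation (q : E) (t : R) : q != 0 -> t != 0 ->
  exists2 phi : 'M[R]_n, \det phi = 1 & forall x, dot q x = 0 -> phi *m x = t *: x.
Proof.
case: n q => [|m] q q0 t0; first by move: q0; rewrite flatmx0 eqxx.
have [B0 B0u Bq] := basis_extension q0.
pose B := B0^T; have Bu : B \in unitmx by rewrite unitmx_tr.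
(* the first coordinate of [B *m x] is [dot q x] *)
pose d : 'rV[R]_m.+1 := \row_j (if j == 0 then (t ^+ m)^-1 else t).
exists (invmx B *m diag_mx d *m B).
  rewrite !det_mulmx mulrAC -det_mulmx mulVmx // det1 mul1r det_diag.
  rewrite big_ord_recl mxE eqxx (eq_bigr (fun=> t)) => [|i _]; last by rewrite mxE.
  by rewrite prodr_const card_ord mulVf // expf_neq0.
move=> x qx; rewrite -!mulmxA -[RHS](mulKmx Bu); congr (_ *m _).
rewrite -scalemxAr; set y := B *m x.
have y0 : y 0 0 = 0 by rewrite -qx -Bq dotC dot_mulmx dot_delta.
clearbody y; apply/matrixP => i j; rewrite mul_diag_mx !mxE (ord1 j).
by case: eqVneq => [->|//]; rewrite y0 !mulr0.
Qed.

(** The second column of a frame starting with the given vector absorbs the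
    determinant. *)
Lemma SL_transitive (x y : E) : (1 < n)%N -> x != 0 -> y != 0 ->
  exists2 phi : 'M[R]_n, \det phi = 1 & phi *m x = y.
Proof.
case: n x y => [|[|m]] // x y _ x0 y0.
suff frame (z : 'cV[R]_m.+2) : z != 0 ->
    exists2 N : 'M[R]_m.+2, \det N = 1 & N *m delta_mx 0 0 = z.
  have [N dN Nx] := frame _ x0; have [N' dN' Ny] := frame _ y0.
  have Nu : N \in unitmx by rewrite unitmxE dN unitr1.
  exists (N' *m invmx N); first by rewrite det_mulmx det_inv dN dN' invr1 mulr1.
  by rewrite -Nx mulmxA mulmxKV.
move=> z0; have [B Bu Bz] := basis_extension z0.
pose d : 'rV[R]_m.+2 := \row_j (if j == lift ord0 ord0 then (\det B)^-1 else 1).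
exists (B *m diag_mx d).
  rewrite det_mulmx det_diag (bigD1 (lift ord0 ord0)) //= big1 => [|j j1]; last first.
    by rewrite mxE (negbTE j1).
  by rewrite mxE eqxx mulr1 mulfV // -unitfE -unitmxE.
rewrite -mulmxA -Bz; congr (_ *m _); apply/matrixP => i j.
rewrite mul_diag_mx !mxE; case: eqVneq => [->|_]; last by rewrite mul1r.
by rewrite mulr0.
Qed.

End Functionals.

(** * Invariant valuations are constant *)

Section Invariant.
Context {R : realType} {n : nat} (n_gt1 : (1 < n)%N).
Local Notation E := 'cV[R]_n.
Implicit Types (x y z : E) (S T A : seq (E * R)) (p : E * R) (t h w : R).
Implicit Types (u v : E -> \bar R).
Context (Y : (E -> \bar R) -> R) (Yc : epi_cont Y).
Context (Yv : forall u v, Conv_sc u -> Conv_sc v ->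
  Conv_sc (fun x => Order.max (u x) (v x)) ->
  Conv_sc (fun x => Order.min (u x) (v x)) ->
  Y (fun x => Order.max (u x) (v x)) + Y (fun x => Order.min (u x) (v x)) = Y u + Y v).
Context (Ysl : forall u (phi : 'M[R]_n), Conv_sc u -> \det phi = 1 ->
  Y (fun y => u (invmx phi *m y)) = Y u).
Context (Yt : forall u y, Conv_sc u -> Y (tau y u) = Y u).
Context (Ys : forall u d, Conv_sc u -> Y (fun z => (u z + d%:E)%E) = Y u).

(** Normalized so as to vanish at indicators of points. *)
Definition excess S := Y (hullf S) - Y (hullf [:: (0, 0)]).

Lemma excess_eq_mem S T : S =i T -> excess S = excess T.
Proof. by move=> ST; rewrite /excess (hullf_eq_mem ST). Qed.

Lemma det1_unit (phi : 'M[R]_n) : \det phi = 1 -> phi \in unitmx.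
Proof. by move=> d1; rewrite unitmxE d1 unitr1. Qed.

Lemma excess_displace (phi : 'M[R]_n) b S : S != [::] -> \det phi = 1 ->
  excess (map (displace phi b) S) = excess S.
Proof.
move=> Sn d1; have phiu := det1_unit d1; congr (_ - _).
have cS := Conv_sc_hullf Sn.
rewrite -[RHS](Ysl cS d1) -[RHS](Yt b).
  by congr Y; apply/funext => x; rewrite hullf_displace.
by apply: Conv_sc_mul => //; rewrite unitmx_inv.
Qed.

Lemma excess_tilt d S : S != [::] -> excess (map (tilt 0 d) S) = excess S.
Proof.
move=> Sn; congr (_ - _); rewrite -(Ys d (Conv_sc_hullf Sn)).
by congr Y; apply/funext => x; rewrite hullf_tilt dot0l add0r.
Qed.

Lemma excess_point p : excess [:: p] = 0.
Proof.
have -> : [:: p] = map (displace 1%:M p.1) (map (tilt 0 p.2) [:: (0, 0)]).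
  by rewrite /= /displace /tilt /= mulmx0 dot0l !add0r -surjective_pairing.
by rewrite excess_displace ?det1 // excess_tilt // /excess subrr.
Qed.

Lemma excess_split l s1 s2 S : 0 < l < 1 ->
  excess (s1 :: s2 :: S) + excess (mid l s1 s2 :: S) =
  excess (mid l s1 s2 :: s2 :: S) + excess (s1 :: mid l s1 s2 :: S).
Proof.
move=> l01; have := @Yv (hullf (mid l s1 s2 :: s2 :: S)) (hullf (s1 :: mid l s1 s2 :: S)).
rewrite -(hullf_split_max s1 s2 S l01) -(hullf_split_min s1 s2 S l01).
have cU p T : Conv_sc (hullf (p :: T)) by exact: Conv_sc_hullf.
by move=> /(_ (cU _ _) (cU _ _) (cU _ _) (cU _ _)); rewrite /excess; lra.
Qed.

Lemma excess_limit (S_ : nat -> seq (E * R)) S : (forall k, S_ k != [::]) -> S != [::] ->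
  epi_cvg (fun k => hullf (S_ k)) (hullf S) -> excess \o S_ @ \oo --> excess S.
Proof.
move=> Skn Sn SS; apply: cvgB; last exact: cvg_cst.
exact: (Yc (fun k => Conv_sc_hullf (Skn k)) (Conv_sc_hullf Sn) SS).
Qed.

(** A function supported in a hyperplane can be shrunk to a point within its SL(n)
    orbit. *)
Lemma excess_hyperplane S (q : E) b : S != [::] -> q != 0 ->
  (forall p, p \in S -> dot q p.1 = b) -> excess S = 0.
Proof.
move=> Sn q0 Sq; have [s0 s0S hs0] := @seq_argmin R _ (fun p => p.2) S Sn.
pose T := map (displace 1%:M (- s0.1)) S.
have Tn : T != [::] by rewrite /T; case: (S) Sn.
have -> : excess S = excess T by rewrite excess_displace ?det1.
have Tq p : p \in T -> dot q p.1 = 0.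
  case/mapP => p' p'S -> /=; rewrite mul1mx dotBr (Sq _ p'S) (Sq _ s0S).
  exact: subrr.
have t0T : displace 1%:M (- s0.1) s0 \in T by exact: map_f.
have ht0 p : p \in T -> (displace 1%:M (- s0.1) s0).2 <= p.2.
  by case/mapP => p' /hs0 + ->.
have := excess_limit _ _ (epi_cvg_shrink t0T ht0).
move=> /(_ _ isT); rewrite excess_point => lim.
have {}lim : (fun=> excess T) @ \oo --> (0 : R).
  apply: cvg_trans (lim _); last by move=> k; case: (T) Tn.
  apply: near_eq_cvg; apply: nearW => k /=.
  have t0 : k.+1%:R^-1 != 0 :> R by rewrite invr_eq0 pnatr_eq0.
  have [phi d1 hphi] := SL_dilation q0 t0.
  rewrite -(@excess_displace phi 0 T) //; congr excess; apply/eq_in_map => p /Tq pq.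
  by rewrite /displace hphi // mul_scalar_mx.
by apply: (cvg_unique _ (@cvg_cst _ (excess T) _ \oo _) lim).
Qed.

(** A point is encoded as the row [(1, x)], so that the determinant of [n + 1] of them
    is the signed volume of their simplex up to a constant factor, and linear
    functionals of the row are affine functions of the point. *)
Definition affine_row x : 'rV[R]_(1 + n) := row_mx 1%:M x^T.

Definition vertex_mx (s : 'I_n.+1 -> E * R) : 'M[R]_(1 + n) := \matrix_i affine_row (s i).1.

Definition simplex_excess (s : 'I_n.+1 -> E * R) := excess (map s (enum 'I_n.+1)).

Lemma enum_neq0 {T : eqType} (s : 'I_n.+1 -> T) : map s (enum 'I_n.+1) != [::].
Proof. by rewrite -size_eq0 size_map size_enum_ord. Qed.

Lemma affine_row_dot x (v : 'cV[R]_(1 + n)) :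
  (affine_row x *m v) 0 0 = v 0 0 + dot (dsubmx v) x.
Proof.
rewrite -{1}[v]vsubmxK mul_row_col mul1mx [LHS]mxE; congr (_ + _); last by rewrite dotC dotE.
by rewrite mxE; congr (v _ _); apply: val_inj.
Qed.

Lemma vertex_mx_mul s (v : 'cV[R]_(1 + n)) i :
  (vertex_mx s *m v) i 0 = v 0 0 + dot (dsubmx v) (s i).1.
Proof.
rewrite -affine_row_dot -[in RHS](rowK (fun i => affine_row (s i).1) i) -row_mul [RHS]mxE.
by [].
Qed.

(** The vertices of a simplex without volume lie in a hyperplane. *)
Lemma simplex_degenerate s : \det (vertex_mx s) = 0 -> simplex_excess s = 0.
Proof.
rewrite -det_tr => /eqP/det0P[v v0 vM].
have hv i : v^T 0 0 + dot (dsubmx v^T) (s i).1 = 0.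
  by rewrite -vertex_mx_mul -[vertex_mx s]trmxK -trmx_mul vM !mxE.
apply: (@excess_hyperplane _ (dsubmx v^T) (- v^T 0 0)).
- exact: enum_neq0.
- apply: contraNneq v0 => q0.
  have := hv ord0; rewrite q0 dot0l addr0 => b0.
  rewrite -[v]trmxK -[v^T]vsubmxK q0 (_ : usubmx _ = 0) ?col_mx0 ?trmx0 //.
  apply/matrixP => i j; rewrite !ord1 [RHS]mxE -b0 mxE; congr (v^T _ _).
  exact: val_inj.
by move=> p /mapP[i _ ->]; apply/eqP; rewrite -subr_eq0 opprK addrC hv.
Qed.

(** Affine maps of determinant [1] act transitively on the simplices of a given signed
    volume, vertex by vertex. *)
Lemma simplex_volume s s' : \det (vertex_mx s) = \det (vertex_mx s') -> \det (vertex_mx s) != 0 ->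
  (forall i, (s i).2 = (s' i).2) -> simplex_excess s = simplex_excess s'.
Proof.
move=> dd d0 hh; have Mu : vertex_mx s \in unitmx by rewrite unitmxE unitfE.
pose X : 'M[R]_(1 + n) := invmx (vertex_mx s) *m vertex_mx s'.
have MX : vertex_mx s *m X = vertex_mx s' by rewrite mulKVmx.
have dX : \det X = 1 by rewrite det_mulmx det_inv -dd mulVf.
pose e : 'cV[R]_(1 + n) := col_mx 1%:M 0.
have Me s1 : vertex_mx s1 *m e = const_mx 1.
  apply/matrixP => i j; rewrite ord1 vertex_mx_mul /e col_mxKd dot0l addr0 !mxE.
  by case: splitP => // k _; rewrite ord1 mxE.
have Xe : X *m e = e.
  by rewrite -mulmxA Me -(Me s) mulKmx.
pose P := drsubmx X; pose r := ursubmx X.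
(* [X] fixes the first coordinate, so it is the matrix of an affine map *)
have XE : X = block_mx 1%:M r 0 P.
  have := Xe; rewrite -{1}[X]submxK /e mul_block_col !mulmx1 !mulmx0 !addr0.
  by move=> /eq_col_mx[x1 x2]; rewrite -{1}[X]submxK x1 x2.
have dP : \det P = 1 by rewrite -dX XE det_ublock det1 mul1r.
have sE i : (s' i).1 = P^T *m (s i).1 + r^T.
  have : affine_row (s' i).1 = affine_row (s i).1 *m X.
    rewrite -(rowK (fun i => affine_row (s' i).1) i) -(rowK (fun i => affine_row (s i).1) i).
    by rewrite -row_mul -/(vertex_mx s) MX.
  rewrite XE /affine_row mul_row_block !mul1mx mulmx0 addr0 => /eq_row_mx[_ e1].
  by apply: trmx_inj; rewrite e1 linearD /= trmx_mul !trmxK addrC.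
rewrite /simplex_excess -(@excess_displace P^T r^T) ?det_tr //; last exact: enum_neq0.
rewrite -map_comp; congr excess; apply: eq_map => i /=.
by rewrite /displace -sE hh -surjective_pairing.
Qed.

Definition upd {T : Type} (s : 'I_n.+1 -> T) (i : 'I_n.+1) (a : T) : 'I_n.+1 -> T :=
  fun k => if k == i then a else s k.

Lemma upd_same {T : Type} (s : 'I_n.+1 -> T) i (a : T) : upd s i a i = a.
Proof. by rewrite /upd eqxx. Qed.

Lemma upd_other {T : Type} (s : 'I_n.+1 -> T) i (a : T) k : k != i -> upd s i a k = s k.
Proof. by rewrite /upd => /negbTE ->. Qed.

Lemma affine_row_mid l p1 p2 :
  affine_row (mid l p1 p2).1 = l *: affine_row p1.1 + (1 - l) *: affine_row p2.1.
Proof.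
rewrite /affine_row !scale_row_mx add_row_mx linearD /= !linearZ /=; congr row_mx.
by rewrite -scalerDl addrC subrK scale1r.
Qed.

Lemma vertex_mx_dup s i j : i != j -> (s i).1 = (s j).1 -> \det (vertex_mx s) = 0.
Proof.
move=> ij sij; apply: (determinant_alternate ij) => k.
by rewrite !mxE sij.
Qed.

Lemma vertex_mx_mid s i j l : i != j ->
  \det (vertex_mx (upd s i (mid l (s i) (s j)))) = l * \det (vertex_mx s).
Proof.
move=> ij; set s' := upd _ _ _.
have := @determinant_multilinear R _ (vertex_mx s') (vertex_mx s) (vertex_mx (upd s i (s j))) i l (1 - l).
rewrite (@vertex_mx_dup (upd s i (s j)) i j) //; last by rewrite upd_same upd_other // eq_sym.
rewrite mulr0 addr0; apply.
- by rewrite !rowK /s' !upd_same affine_row_mid.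
- by apply/row_matrixP => k; rewrite !row_rowsub !rowK /s' upd_other // eq_sym neq_lift.
- by apply/row_matrixP => k; rewrite !row_rowsub !rowK /s' !upd_other // eq_sym neq_lift.
Qed.

Lemma midC l p1 p2 : mid l p1 p2 = mid (1 - l) p2 p1.
Proof. by rewrite /mid subKr [_ *: _ + _]addrC [_ * _ + _]addrC. Qed.

(** The intersection of the two halves has a repeated vertex, hence no excess. *)
Lemma simplex_cut s i j l : i != j -> 0 < l < 1 ->
  simplex_excess s = simplex_excess (upd s i (mid l (s i) (s j))) + simplex_excess (upd s j (mid l (s i) (s j))).
Proof.
move=> ij l01; set m := mid _ _ _.
pose A := [seq s k | k <- enum 'I_n.+1 & (k != i) && (k != j)].
have AP (z : E * R) : reflect (exists k, [/\ k != i, k != j & z = s k]) (z \in A).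
  apply: (iffP mapP) => [[k + ->]|[k [ki kj ->]]].
    by rewrite mem_filter => /andP[/andP[ki kj] _]; exists k.
  by exists k; rewrite // mem_filter ki kj mem_enum.
have ji : j != i by rewrite eq_sym.
have e0 : simplex_excess s = excess (s i :: s j :: A).
  apply: excess_eq_mem => z; rewrite !inE; apply/mapP/or3P => [[k _ ->]|].
    have [->|ki] := eqVneq k i; first by constructor 1.
    have [->|kj] := eqVneq k j; first by constructor 2.
    by constructor 3; apply/AP; exists k.
  by case=> [/eqP ->|/eqP ->|/AP[k [_ _ ->]]]; [exists i|exists j|exists k];
    rewrite ?mem_enum.
have e1 : simplex_excess (upd s i m) = excess (m :: s j :: A).
  apply: excess_eq_mem => z; rewrite !inE; apply/mapP/or3P => [[k _ ->]|].
    have [->|ki] := eqVneq k i; first by rewrite upd_same; constructor 1.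
    rewrite upd_other //; have [->|kj] := eqVneq k j; first by constructor 2.
    by constructor 3; apply/AP; exists k.
  case=> [/eqP ->|/eqP ->|/AP[k [ki kj ->]]]; [exists i|exists j|exists k];
    by rewrite ?mem_enum ?upd_same ?upd_other.
have e2 : simplex_excess (upd s j m) = excess (s i :: m :: A).
  apply: excess_eq_mem => z; rewrite !inE; apply/mapP/or3P => [[k _ ->]|].
    have [->|ki] := eqVneq k j; first by rewrite upd_same; constructor 2.
    rewrite upd_other //; have [->|kj] := eqVneq k i; first by constructor 1.
    by constructor 3; apply/AP; exists k.
  case=> [/eqP ->|/eqP ->|/AP[k [ki kj ->]]]; [exists i|exists j|exists k];
    by rewrite ?mem_enum ?upd_same ?upd_other.
have e3 : simplex_excess (upd (upd s i m) j m) = excess (m :: A).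
  apply: excess_eq_mem => z; rewrite !inE; apply/mapP/orP => [[k _ ->]|].
    have [->|kj] := eqVneq k j; first by rewrite upd_same; left.
    rewrite upd_other //; have [->|ki] := eqVneq k i; first by rewrite upd_same; left.
    by rewrite upd_other //; right; apply/AP; exists k.
  case=> [/eqP ->|/AP[k [ki kj ->]]]; [exists j|exists k];
    by rewrite ?mem_enum ?upd_same ?upd_other.
have := excess_split (s i) (s j) A l01; rewrite -/m -e0 -e1 -e2 -e3.
rewrite (@simplex_degenerate (upd (upd s i m) j m)) ?addr0 //.
by apply: (vertex_mx_dup ij); rewrite upd_same upd_other // upd_same.
Qed.

Lemma mid_height l p1 p2 : p1.2 = p2.2 -> (mid l p1 p2).2 = p2.2.
Proof. by move=> e; rewrite /= e; ring. Qed.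

Lemma vertex_mx_mid' s i j l : i != j ->
  \det (vertex_mx (upd s j (mid l (s i) (s j)))) = (1 - l) * \det (vertex_mx s).
Proof. by move=> ij; rewrite midC vertex_mx_mid // eq_sym. Qed.

Let half01 : 0 < (2^-1 : R) < 1.
Proof. by apply/andP; split; lra. Qed.

(** Cutting an edge between equal heights in the middle gives two halves with the
    same volume and the same heights. *)
Lemma simplex_half_eq s s' i j : i != j -> (s i).2 = (s j).2 ->
  (forall k, (s k).2 = (s' k).2) -> 2 * \det (vertex_mx s') = \det (vertex_mx s) ->
  simplex_excess s = 2 * simplex_excess s'.
Proof.
move=> ij sij hh d2; have [d0|d0] := eqVneq (\det (vertex_mx s')) 0.
  by rewrite !simplex_degenerate ?mulr0 // -d2 d0 mulr0.
have hm k : (upd s i (mid 2^-1 (s i) (s j)) k).2 = (s' k).2.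
  rewrite /upd; case: eqVneq => [->|_]; rewrite ?mid_height // -hh //.
have hm' k : (upd s j (mid 2^-1 (s i) (s j)) k).2 = (s' k).2.
  rewrite /upd; case: eqVneq => [->|_]; rewrite ?mid_height // -hh //.
rewrite (simplex_cut s ij half01) (@simplex_volume _ s') ?(@simplex_volume (upd s j _) s') //.
- by ring.
- by rewrite vertex_mx_mid' // -d2; lra.
- by rewrite vertex_mx_mid' // -d2 mulf_neq0 ?mulf_neq0 //; apply/eqP; lra.
- by rewrite vertex_mx_mid // -d2 mulKf // pnatr_eq0.
- by rewrite vertex_mx_mid // -d2 mulKf // pnatr_eq0.
Qed.

Lemma middle_value (c : 'I_n.+1 -> R) : exists i j k,
  [/\ i != j, i != k, j != k, c i <= c k & c k <= c j].
Proof.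
pose o0 : 'I_n.+1 := ord0.
pose o1 : 'I_n.+1 := Ordinal (ltnW (n_gt1 : (1 < n.+1.-1)%N) : (1 < n.+1)%N).
pose o2 : 'I_n.+1 := Ordinal (n_gt1 : (2 < n.+1)%N).
have [h01|h01] := leP (c o0) (c o1); have [h12|h12] := leP (c o1) (c o2).
- by exists o0, o2, o1; split.
- have [h02|h02] := leP (c o0) (c o2).
    by exists o0, o1, o2; split=> //; exact: ltW.
  by exists o2, o1, o0; split=> //; exact: ltW.
- have [h02|h02] := leP (c o0) (c o2).
    by exists o1, o2, o0; split=> //; exact: ltW.
  by exists o1, o0, o2; split=> //; exact: ltW.
by exists o2, o0, o1; split=> //; exact: ltW.
Qed.

(** The excess is proportional to the volume.  This holds for simplices with two equal
    heights, and any simplex is cut into two of these at the middle one of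
    three heights. *)
Lemma simplex_half s s' : (forall k, (s k).2 = (s' k).2) ->
  2 * \det (vertex_mx s') = \det (vertex_mx s) -> simplex_excess s = 2 * simplex_excess s'.
Proof.
move=> hh d2; have [i [j [k [ij ik jk cik ckj]]]] := middle_value (fun k => (s k).2).
have [e|nik] := eqVneq (s i).2 (s k).2; first exact: (simplex_half_eq ik).
have [e|nkj] := eqVneq (s k).2 (s j).2.
  by apply: (simplex_half_eq jk).
have lik : (s i).2 < (s k).2 by rewrite lt_neqAle nik.
have lkj : (s k).2 < (s j).2 by rewrite lt_neqAle nkj.
(* the cut vertex gets the height of the vertex [k] *)
pose l := ((s j).2 - (s k).2) / ((s j).2 - (s i).2).
have D0 : 0 < (s j).2 - (s i).2 by rewrite subr_gt0 (lt_trans lik).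
have l01 : 0 < l < 1.
  apply/andP; rewrite /l; split; first by rewrite divr_gt0 // subr_gt0.
  by rewrite ltr_pdivrMr // mul1r; lra.
have lE : l * (s i).2 + (1 - l) * (s j).2 = (s k).2.
  by rewrite /l; field; rewrite gt_eqF.
have lE' : l * (s' i).2 + (1 - l) * (s' j).2 = (s k).2 by rewrite -!hh.
have ki : k != i by rewrite eq_sym.
have kj : k != j by rewrite eq_sym.
rewrite (simplex_cut s ij l01) (simplex_cut s' ij l01) mulrDr; congr (_ + _).
  apply: (simplex_half_eq ik).
  - by rewrite upd_same upd_other.
  - by move=> k'; rewrite /upd; case: eqVneq => // _; rewrite /= lE lE'.
  - by rewrite !vertex_mx_mid // -d2; ring.
apply: (simplex_half_eq jk).
- by rewrite upd_same upd_other.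
- by move=> k'; rewrite /upd; case: eqVneq => // _; rewrite /= lE lE'.
- by rewrite !vertex_mx_mid' // -d2; ring.
Qed.

Section Simplex.
Context (a : 'I_n.+1 -> E).

Let f (c : 'I_n.+1 -> R) := simplex_excess (fun i => (a i, c i)).

(** Both halves of a simplex are brought back to the original volume by
    [simplex_half]. *)
Lemma simplex_heights_mid c i j : i != j ->
  f c = 2^-1 * (f (upd c i ((c i + c j) / 2)) + f (upd c j ((c i + c j) / 2))).
Proof.
move=> ij; pose s i := (a i, c i); rewrite /f (simplex_cut s ij half01).
have mE : 2^-1 * c i + (1 - 2^-1) * c j = (c i + c j) / 2 by lra.
have dE c' : vertex_mx (fun k => (a k, c' k)) = vertex_mx s by [].
rewrite (@simplex_half (fun k => (a k, upd c i _ k)) (upd s i (mid 2^-1 (s i) (s j)))).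
- rewrite (@simplex_half (fun k => (a k, upd c j _ k)) (upd s j (mid 2^-1 (s i) (s j)))).
  + by rewrite -mulrDr mulKf // pnatr_eq0.
  + by move=> k; rewrite /upd; case: eqVneq => //= _; rewrite mE.
  + by rewrite dE vertex_mx_mid' //; lra.
- by move=> k; rewrite /upd; case: eqVneq => //= _; rewrite mE.
- by rewrite dE vertex_mx_mid //; lra.
Qed.

Lemma simplex_heights_cst c t : f (fun i => c i + t) = f c.
Proof.
rewrite /f /simplex_excess -(@excess_tilt t (map (fun i => (a i, c i)) _)); last exact: enum_neq0.
congr (excess _); rewrite -[RHS]map_comp; apply: eq_map => i /=.
by rewrite /tilt /= dot0l add0r.
Qed.

Lemma simplex_heights_cont (e : R) : 0 < e -> exists2 d : R, 0 < d &
  forall c, (forall i, `|c i| <= d) -> `|f c - f (fun=> 0)| <= e.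
Proof.
move=> e0; apply: contrapT => nd.
have bad (k : nat) : exists c, (forall i, `|c i| <= k.+1%:R^-1) /\
    e < `|f c - f (fun=> 0)|.
  apply: contrapT => nc; apply: nd; exists k.+1%:R^-1; first by rewrite invr_gt0.
  move=> c hc; rewrite leNgt; apply/negP => ec; apply: nc; by exists c.
have [c hc] := choice bad.
have Sn (c' : 'I_n.+1 -> R) : map (fun i => (a i, c' i)) (enum 'I_n.+1) != [::].
  exact: enum_neq0.
have cU : epi_cvg (fun k => hullf (map (fun i => (a i, c k i)) (enum 'I_n.+1)))
    (hullf (map (fun i => (a i, 0)) (enum 'I_n.+1))).
  apply: (@epi_cvg_uniform _ _ _ _ (fun k => k.+1%:R^-1)).
  - exact/Conv_sc_hullf/Sn.
  - exact: cvg_harmonic.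
  - move=> k x; apply: (@hullf_heights _ _ _ _ a (fun=> 0) (c k)) => i _.
    by rewrite add0r (le_trans (ler_norm _)) // (hc k).1.
  move=> k x; apply: (@hullf_heights _ _ _ _ a (c k) (fun=> 0)) => i _.
  by rewrite -lerBlDl sub0r (le_trans (ler_norm _)) // normrN (hc k).1.
have lim := excess_limit (fun k => Sn (c k)) (Sn (fun=> 0)) cU.
have : \forall k \near \oo, `|f (fun=> 0) - f (c k)| < e.
  exact: cvgr_dist_lt lim _ e0.
case=> N _ /(_ N (leqnn N)) /=; rewrite distrC => h.
by have := lt_trans h (hc N).2; rewrite ltxx.
Qed.

(** By continuity the heights do not matter when they are nearly constant.  The bound
    on their spread is then enlarged step by step: heights near the two ends of the
    range are averaged away by [simplex_heights_mid]. *)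
Lemma simplex_heights_const c : f c = f (fun=> 0).
Proof.
apply/eqP; rewrite -subr_eq0 -normr_eq0 eq_le normr_ge0 andbT.
apply/ler_addgt0Pr => e e0; rewrite add0r.
have [d d0 hd] := simplex_heights_cont e0.
pose P r := forall (A : R) c, (forall i, A <= c i <= A + r) -> `|f c - f (fun=> 0)| <= e.
suff H (k : nat) : P (d + k%:R * (d / 4)).
  pose M := \sum_i `|c i|.
  have cM i : `|c i| <= M.
    by rewrite /M (bigD1 i) //= lerDl sumr_ge0.
  pose k := Num.bound `|2 * M / (d / 4)|.
  apply: (H k (- M)) => i.
  have : 2 * M / (d / 4) < k%:R.
    by apply: le_lt_trans (ler_norm _) _; apply: archi_boundP; rewrite normr_ge0.
  rewrite ltr_pdivrMr ?divr_gt0 // => Mk.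
  by have := cM i; rewrite ler_norml => /andP[h1 h2]; apply/andP; split; lra.
elim: k => [|k IH].
  move=> A c' hc; rewrite -(simplex_heights_cst c' (- A)); apply: hd => i.
  by have := hc i; rewrite ler_norml; lra.
set r := d + k%:R * (d / 4) in IH *.
have rd : d <= r by rewrite lerDl mulr_ge0 // divr_ge0 // ltW.
have -> : d + k.+1%:R * (d / 4) = r + d / 4 by rewrite /r -natr1; ring.
(* heights lying at the two ends of the range, of which every averaging step
   below removes at least one *)
pose ext (A : R) (y : R) := (y < A + d / 4) || (A + r < y).
move=> A c'; have [m] := ubnP #|[pred i | ext A (c' i)]|.
elim: m c' => // m IHm c' cm hc.
have [/forallP lo|] := boolP [forall i, A + d / 4 <= c' i].
  apply: (IH (A + d / 4)) => i; rewrite lo /=.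
  by have /andP[_] := hc i; lra.
rewrite negb_forall => /existsP[i]; rewrite -ltNge => ci.
have [/forallP hi|] := boolP [forall i, c' i <= A + r].
  by apply: (IH A) => i'; rewrite hi andbT; have /andP[] := hc i'.
rewrite negb_forall => /existsP[j]; rewrite -ltNge => cj.
have ij : i != j by apply: contraTneq ci => ->; rewrite -leNgt; lra.
set mm := (c' i + c' j) / 2.
have hmm : A + d / 4 <= mm /\ mm <= A + r.
  have := hc i; have := hc j; rewrite /mm; split; lra.
have less i0 : ext A (c' i0) -> (#|[pred k | ext A (upd c' i0 mm k)]| < m)%N.
  move=> ei0; rewrite ltnS in cm; apply: (leq_trans _ cm); apply: proper_card; apply/properP; split.
    apply/fintype.subsetP => k'; rewrite !inE /upd; case: eqVneq => [->|//].
    by rewrite /ext !ltNge (proj1 hmm) (proj2 hmm).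
  exists i0; rewrite !inE //= upd_same /ext.
  by rewrite !ltNge (proj1 hmm) (proj2 hmm).
have bnd i0 i1 : A <= upd c' i0 mm i1 <= A + (r + d / 4).
  rewrite /upd; case: eqVneq => _ //.
  by case: hmm => h1 h2; apply/andP; split; lra.
have := IHm (upd c' i mm) (less _ _) (bnd i).
have := IHm (upd c' j mm) (less _ _) (bnd j).
rewrite /ext ci cj orbT /= => /(_ isT) hj /(_ isT) hi.
rewrite (simplex_heights_mid c' ij) -/mm.
rewrite (_ : _ - _ = 2^-1 * ((f (upd c' i mm) - f (fun=> 0)) +
   (f (upd c' j mm) - f (fun=> 0)))); last by lra.
rewrite normrM ger0_norm ?invr_ge0 // ler_pdivrMl //.
by apply: le_trans (ler_normD _ _) _; lra.
Qed.

End Simplex.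

(** Raising one vertex to infinity leaves the opposite facet, without excess, while
    the excess of the simplex does not change. *)
Lemma simplex_excess_eq0 s : simplex_excess s = 0.
Proof.
have [/simplex_degenerate //|d0] := eqVneq (\det (vertex_mx s)) 0.
pose a i := (s i).1.
have -> : simplex_excess s = simplex_excess (fun i => (a i, (s i).2)).
  by congr (excess _); apply: eq_map => i; rewrite -surjective_pairing.
rewrite simplex_heights_const.
have Mu : vertex_mx s \in unitmx by rewrite unitmxE unitfE.
pose v : 'cV[R]_(1 + n) := invmx (vertex_mx s) *m delta_mx ord0 0.
have hv i : dot (dsubmx v) (a i) + v 0 0 = (i == ord0)%:R.
  by rewrite addrC -vertex_mx_mul mulKVmx // mxE eqxx andbT.
pose o1 : 'I_n.+1 := Ordinal (ltnW (n_gt1 : (1 < n.+1.-1)%N) : (1 < n.+1)%N).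
have q0 : dsubmx v != 0.
  apply/eqP => q0; have := hv ord0; have := hv o1.
  rewrite q0 !dot0l !add0r => -> /eqP.
  by rewrite /= eq_sym oner_eq0.
pose S := map (fun i => (a i, 0 : R)) (enum 'I_n.+1).
have Sn : S != [::] by exact: enum_neq0.
have pos p : p \in S -> 0 <= dot (dsubmx v) p.1 + v 0 0.
  by case/mapP => i _ ->; rewrite hv ler0n.
have S1 : (a o1, 0) \in [seq p <- S | dot (dsubmx v) p.1 + v 0 0 == 0].
  by rewrite mem_filter /= hv eqxx; apply/mapP; exists o1; rewrite ?mem_enum.
have S0n : [seq p <- S | dot (dsubmx v) p.1 + v 0 0 == 0] != [::].
  by apply: contraTneq S1 => ->.
have Tn k : map (tilt (k%:R *: dsubmx v) (k%:R * v 0 0)) S != [::].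
  by case: (S) Sn.
have := excess_limit Tn S0n (epi_cvg_face Sn pos).
rewrite (_ : excess \o _ = fun=> simplex_excess (fun i => (a i, 0))); last first.
  apply/funext => k /=.
  rewrite -(@simplex_heights_const a (fun i => k%:R * (i == ord0)%:R)).
  congr (excess _); rewrite -[LHS]map_comp; apply: eq_map => i /=.
  by rewrite /tilt /= dotZl -mulrDr hv add0r.
move=> lim; have -> := cvg_unique (@Rhausdorff R) (@cvg_cst _ _ _ \oo _) lim.
apply: (@excess_hyperplane _ (dsubmx v) (- v 0 0)) => // p.
by rewrite mem_filter addr_eq0 => /andP[/eqP].
Qed.

Lemma excess_small S : S != [::] -> (size S <= n.+1)%N -> excess S = 0.
Proof.
case: S => // p0 S _ sS; rewrite -(simplex_excess_eq0 (fun i => nth p0 (p0 :: S) i)).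
apply: excess_eq_mem => p; apply/idP/mapP => [pS|[i _ ->]].
  have ip : (index p (p0 :: S) < n.+1)%N.
    by apply: leq_trans sS; rewrite index_mem.
  by exists (Ordinal ip); rewrite ?mem_enum //= nth_index.
have [iS|iS] := ltnP i (size (p0 :: S)); first exact: mem_nth.
by rewrite nth_default ?mem_head.
Qed.

(** If a convex combination of the points [J] lies above the hull of [S], cutting at a
    point of an edge of [J] merges two points of [J] into one in each half, and a
    single point of [J] is redundant. *)
Lemma excess_circuit m : (forall T, T != [::] -> (size T < m)%N -> excess T = 0) ->
  forall (J : seq (R * (E * R))) S h, J != [::] -> S != [::] ->
  (size J + size S = m)%N -> (forall j, j \in J -> 0 < j.1) ->
  comb S (\sum_(j <- J) j.1) (\sum_(j <- J) j.1 *: j.2.1) h ->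
  h <= \sum_(j <- J) j.1 * j.2.2 -> excess (map snd J ++ S) = 0.
Proof.
move=> IHm J; have [k] := ubnP (size J).
elim: k J => // k IHk [|j1 [|j2 J]] // sJ S h _ Sn szm posJ.
  rewrite !big_seq1 /= => c hh; have w0 := posJ _ (mem_head _ _).
  have w0' := gt_eqF w0.
  rewrite /excess hullf_redundant; first by apply: (IHm _ Sn); rewrite -szm addnC addn1.
  have wi : 0 <= j1.1^-1 by rewrite invr_ge0 ltW.
  exists (j1.1^-1 * h); last by rewrite ler_pdivrMl.
  by apply: (comb_cast (combZ wi c)) => //; rewrite ?scalerA mulVf ?w0' ?scale1r.
rewrite !big_cons => c hh.
have w1 : 0 < j1.1 by apply: posJ; rewrite mem_head.
have w2 : 0 < j2.1 by apply: posJ; rewrite !inE eqxx orbT.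
pose W := j1.1 + j2.1; have W0 : 0 < W by rewrite addr_gt0.
have Wn : W != 0 by rewrite gt_eqF.
pose l := j1.1 / W.
have l01 : 0 < l < 1.
  apply/andP; rewrite /l; split; first by rewrite divr_gt0.
  by rewrite ltr_pdivrMr // mul1r /W ltrDl.
pose p := mid l j1.2 j2.2.
have Wp1 : W *: p.1 = j1.1 *: j1.2.1 + j2.1 *: j2.2.1.
  by apply/matrixP => i i'; rewrite !mxE /l /W; field.
have Wp2 : W * p.2 = j1.1 * j1.2.2 + j2.1 * j2.2.2.
  by rewrite /p /= /l /W; field.
have posJ' j : j \in (W, p) :: J -> 0 < j.1.
  rewrite inE => /orP[/eqP -> //|jJ]; apply: posJ.
  by rewrite !inE jJ !orbT.
have main s : excess ((p :: map snd J) ++ s :: S) = 0.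
  apply: (IHk ((W, p) :: J) _ (s :: S) h _ _ _ posJ') => //=.
  - by rewrite -szm /= !addSn addnS.
  - rewrite !big_cons /= Wp1; apply: comb_tail.
    by apply: (comb_cast c); rewrite // addrA.
  - by rewrite big_cons /= Wp2 -addrA.
have swap s : excess (p :: s :: map snd J ++ S) = 0.
  rewrite -(main s); apply: excess_eq_mem => z.
  by rewrite /= !(inE, mem_cat); congr (_ || _); exact: orbCA.
have := excess_split j1.2 j2.2 (map snd J ++ S) l01; rewrite -/p.
rewrite swap (_ : excess (j1.2 :: p :: _) = 0); last first.
  rewrite -[RHS](swap j1.2); apply: excess_eq_mem => z.
  by rewrite !inE orbCA.
rewrite (IHm (p :: map snd J ++ S)) //; first by rewrite !addr0 => ->.
by rewrite -szm /= size_cat size_map.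
Qed.

Lemma comb_sum (I : eqType) (r : seq I) (p : I -> E * R) (w : I -> R) :
  (forall i, i \in r -> 0 <= w i) ->
  comb (map p r) (\sum_(i <- r) w i) (\sum_(i <- r) w i *: (p i).1)
       (\sum_(i <- r) w i * (p i).2).
Proof.
elim: r => [|i r IH] w0; first by rewrite !big_nil.
rewrite !big_cons; apply: comb_cons; first by rewrite w0 ?mem_head.
by apply: IH => j jr; rewrite w0 // inE jr orbT.
Qed.

(** More than [n + 1] points are affinely dependent.  The positive and the negative
    coefficients give two convex combinations over the same base point, and
    [excess_circuit] applies to the upper one. *)
Lemma excess_eq0 S : S != [::] -> excess S = 0.
Proof.
have [m] := ubnP (size S); elim: m S => // m IH S sm Sn.
have [|nS] := leqP (size S) n.+1; first exact: excess_small.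
case: S Sn sm nS => // p0 S _; set T := p0 :: S => sm nS.
pose p (i : 'I_(size T)) := nth p0 T i.
pose M : 'M[R]_(size T, 1 + n) := \matrix_i affine_row (p i).1.
have /rowV0Pn[v /sub_kermxP vM v0] : kermx M != 0.
  rewrite kermx_eq0 /row_free; apply: contraTneq nS => rM.
  by rewrite -leqNgt -rM rank_leq_col.
(* the sign of the dependency decides which combination is the upper one *)
wlog vc : v vM v0 / \sum_i v 0 i * (p i).2 <= 0 => [hw|].
  have [|/ltW vc] := leP (\sum_i v 0 i * (p i).2) 0; first exact: hw.
  apply: (hw (- v)); rewrite ?mulNmx ?vM ?oppr0 ?oppr_eq0 //.
  rewrite (eq_bigr (fun i => - (v 0 i * (p i).2))) => [|i _]; last by rewrite mxE mulNr.
  by rewrite sumrN oppr_le0.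
have vhom : \sum_i v 0 i *: affine_row (p i).1 = 0.
  apply: etrans vM; rewrite mulmx_sum_row; apply: eq_bigr => i _.
  by rewrite rowK.
have [v1 vx] : \sum_i v 0 i = 0 /\ \sum_i v 0 i *: (p i).1 = 0.
  split.
    have := congr1 (fun B : 'rV[R]_(1 + n) => B 0 (lshift n 0)) vhom.
    rewrite summxE [RHS]mxE => h; rewrite -[RHS]h; apply: eq_bigr => i _.
    by rewrite mxE row_mxEl mxE eqxx mulr1.
  apply/matrixP => k k'; rewrite ord1 summxE [RHS]mxE.
  have := congr1 (fun B : 'rV[R]_(1 + n) => B 0 (rshift 1 k)) vhom.
  rewrite summxE [RHS]mxE => h; rewrite -[RHS]h; apply: eq_bigr => i _.
  by rewrite [LHS]mxE [RHS]mxE row_mxEr mxE.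
pose r := enum 'I_(size T).
have split_sum (V : zmodType) (g : 'I_(size T) -> V) : \sum_i g i =
    \sum_(i <- [seq i <- r | 0 <= v 0 i]) g i + \sum_(i <- [seq i <- r | v 0 i < 0]) g i.
  rewrite (bigID (fun i => 0 <= v 0 i)) /= !big_filter !big_enum_cond /=.
  by congr (_ + _); apply: eq_bigl => i; rewrite -ltNge.
pose J := [seq (- v 0 i, p i) | i <- r & v 0 i < 0].
pose Q := [seq p i | i <- r & 0 <= v 0 i].
have TE : T =i map snd J ++ Q.
  move=> z; rewrite mem_cat; apply/idP/orP => [zT|].
    have iz : (index z T < size T)%N by rewrite index_mem.
    have pz : p (Ordinal iz) = z by rewrite /p nth_index.
    have [vi|vi] := ltP (v 0 (Ordinal iz)) 0; [left|right].
      apply/mapP; exists (- v 0 (Ordinal iz), z) => //.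
      by apply/mapP; exists (Ordinal iz); rewrite ?pz // mem_filter vi mem_enum.
    by apply/mapP; exists (Ordinal iz); rewrite // mem_filter vi mem_enum.
  by case=> [/mapP[_ /mapP[i _ ->] ->]|/mapP[i _ ->]]; rewrite mem_nth.
have JQ : (size J + size Q = size T)%N.
  rewrite !size_map !size_filter addnC -[RHS](size_enum_ord (size T)).
  rewrite -(count_predC (fun i => 0 <= v 0 i)); congr (_ + _)%N.
  by apply: eq_count => i /=; rewrite ltNge.
have negv : exists i, v 0 i < 0.
  apply/existsP; apply: contraNT v0; rewrite negb_exists => /forallP nv.
  have v_ge0 i : 0 <= v 0 i by rewrite leNgt.
  apply/eqP/matrixP => i j; rewrite ord1 mxE; apply/eqP.
  have : \sum_i v 0 i == 0 by rewrite v1.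
  by rewrite psumr_eq0 // => /allP/(_ j (mem_index_enum _)).
have posv : exists i, 0 <= v 0 i.
  apply: contrapT => nex; have nv i : v 0 i < 0.
    by rewrite ltNge; apply/negP => vi; apply: nex; exists i.
  have [i0 i0v] := negv.
  have : \sum_i v 0 i < 0.
    rewrite (bigD1 i0) //= -[ltRHS]addr0; apply: ltr_leD => //.
    by apply: sumr_le0 => i _; exact: ltW.
  by rewrite v1 ltxx.
have Jn : J != [::].
  have [i vi] := negv; rewrite /J; apply/eqP => J0.
  have : (- v 0 i, p i) \in J by apply/mapP; exists i; rewrite // mem_filter vi mem_enum.
  by rewrite /J J0.
have Qn : Q != [::].
  have [i vi] := posv; rewrite /Q; apply/eqP => Q0.
  have : p i \in Q by apply/mapP; exists i; rewrite // mem_filter vi mem_enum.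
  by rewrite /Q Q0.
rewrite (excess_eq_mem TE).
have sums : [/\ \sum_(j <- J) j.1 = \sum_(i <- [seq i <- r | 0 <= v 0 i]) v 0 i,
   \sum_(j <- J) j.1 *: j.2.1 = \sum_(i <- [seq i <- r | 0 <= v 0 i]) v 0 i *: (p i).1 &
   \sum_(i <- [seq i <- r | 0 <= v 0 i]) v 0 i * (p i).2 <= \sum_(j <- J) j.1 * j.2.2].
  rewrite /J !big_map /=; split.
  - by apply/eqP; rewrite sumrN -subr_eq0 -opprD addrC -split_sum v1 oppr0.
  - rewrite (eq_bigr (fun i => - (v 0 i *: (p i).1))) => [|i _]; last by rewrite scaleNr.
    by apply/eqP; rewrite sumrN -subr_eq0 -opprD addrC -split_sum vx oppr0.
  - rewrite [leRHS](eq_bigr (fun i => - (v 0 i * (p i).2))) => [|i _]; last by rewrite mulNr.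
    by rewrite sumrN -subr_le0 opprK -split_sum.
have [e1 e2 e3] := sums.
have cQ : comb Q (\sum_(j <- J) j.1) (\sum_(j <- J) j.1 *: j.2.1)
    (\sum_(i <- [seq i <- r | 0 <= v 0 i]) v 0 i * (p i).2).
  rewrite e1 e2; apply: comb_sum => i.
  by rewrite mem_filter => /andP[].
apply: (@excess_circuit (size T) _ J Q _ Jn Qn JQ _ cQ e3).
  by move=> T' Tn' sT; apply: IH => //; exact: leq_trans sT _.
by move=> j /mapP[i + ->]; rewrite mem_filter oppr_gt0 => /andP[].
Qed.

Lemma invariant_valuation_cst u : Conv_sc u -> Y u = Y (hullf [:: (0, 0)]).
Proof.
apply: (epi_cont_hulls Yc) => S Sn; apply/eqP; rewrite -subr_eq0.
by apply/eqP; exact: excess_eq0.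
Qed.

End Invariant.

(** * The Legendre transform *)

Section Legendre.
Context {R : realType} {n : nat}.
Local Notation E := 'cV[R]_n.
Implicit Types (x y z : E) (t h w : R) (u v : E -> \bar R).

(** The transform is finite on [Conv_sc], so a real-valued version loses nothing there. *)
Definition conjugate u x : R := fine (legendre u x).

Lemma legendre_leP u x (a : R) :
  (legendre u x <= a%:E)%E <-> forall y, ((dot x y - a)%:E <= u y)%E.
Proof.
have e y : (((dot x y)%:E - u y <= a%:E) = ((dot x y - a)%:E <= u y))%E.
  case: (u y) => [r| |] //=; rewrite ?leNye ?leey //.
  by rewrite -EFinB !lee_fin lerBlDr lerBlDl.
split=> [h y|h]; first by rewrite -e; apply: le_trans h; apply: ereal_sup_ubound; exists y.
by apply: ge_ereal_sup => _ [y _ <-]; rewrite e.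
Qed.

Lemma legendre_fin u x : Conv_sc u -> legendre u x \is a fin_num.
Proof.
move=> /Conv_scP[uN _ _ [p [h up]] su].
have [B hB] := su (n%:R * `|x|).
have ub : (legendre u x <= B%:E)%E.
  apply/legendre_leP => y; apply: le_trans (hB y); rewrite lee_fin lerD2r.
  exact: le_trans (ler_norm _) (dot_le_norm _ _).
have lb : ((dot x p - h)%:E <= legendre u x)%E.
  apply: (@le_trans _ _ ((dot x p)%:E - u p)%E); last by apply: ereal_sup_ubound; exists p.
  by rewrite EFinB leeB.
by move: ub lb; case: (legendre u x).
Qed.

Lemma conjugateE u x : Conv_sc u -> (conjugate u x)%:E = legendre u x.
Proof. by move=> /(legendre_fin x) /fineK. Qed.

Lemma conjugate_leP u x a : Conv_sc u ->
  conjugate u x <= a <-> forall y, ((dot x y - a)%:E <= u y)%E.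
Proof. by move=> cu; rewrite -lee_fin conjugateE //; exact: legendre_leP. Qed.

Lemma conjugate_ge u x y h : Conv_sc u -> (u y <= h%:E)%E -> dot x y - h <= conjugate u x.
Proof.
move=> cu uy; have /(conjugate_leP x _ cu)/(_ y) := lexx (conjugate u x).
by move=> /le_trans/(_ uy); rewrite lee_fin lerBlDr lerBlDl addrC.
Qed.

Lemma conjugate_young u x y : Conv_sc u -> ((dot x y - conjugate u x)%:E <= u y)%E.
Proof. by move=> cu; have := lexx (conjugate u x); move/(conjugate_leP x _ cu). Qed.

Lemma conjugate_gtP u x a : Conv_sc u -> a < conjugate u x ->
  exists y, (u y < (dot x y - a)%:E)%E.
Proof.
move=> cu ax; apply: contrapT => /forallNP nx.
move: ax; rewrite ltNge => /negP; apply; apply/conjugate_leP => // y.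
by rewrite leNgt; apply/negP.
Qed.

Lemma eq_real_le (a b : R) : (forall c, a <= c <-> b <= c) -> a = b.
Proof.
by move=> h; apply/eqP; rewrite eq_le; apply/andP; split; apply/h.
Qed.

Lemma conjugate_mulmx u (phi : 'M[R]_n) x : Conv_sc u -> phi \in unitmx ->
  conjugate (fun y => u (invmx phi *m y)) x = conjugate u (phi^T *m x).
Proof.
move=> cu phiu; have cu' : Conv_sc (fun y => u (invmx phi *m y)).
  by apply: Conv_sc_mul => //; rewrite unitmx_inv.
apply: eq_real_le => c; split=> /conjugate_leP h; apply/conjugate_leP => // y.
  by have := h cu' (phi *m y); rewrite mulKmx // dot_mulmx.
by have := h cu (invmx phi *m y); rewrite -dot_mulmx mulKVmx.
Qed.

Lemma conjugate_tau u y x : Conv_sc u -> conjugate (tau y u) x = conjugate u x + dot x y.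
Proof.
move=> cu; have cu' := Conv_sc_tau y cu.
apply: eq_real_le => c; rewrite -lerBrDr.
split=> /conjugate_leP h; apply/conjugate_leP => // z.
  have := h cu' (z + y); rewrite /tau addrK dotDr.
  by rewrite (_ : _ + _ - c = dot x z - (c - dot x y)) //; ring.
have := h cu (z - y); rewrite /tau dotBr.
by rewrite (_ : _ - _ - _ = dot x z - c) //; ring.
Qed.

Lemma conjugate_lin u y x : Conv_sc u ->
  conjugate (fun z => (u z + (dot z y)%:E)%E) x = conjugate u (x - y).
Proof.
move=> cu; have cu' := Conv_sc_lin y cu.
apply: eq_real_le => c; split=> /conjugate_leP h; apply/conjugate_leP => // z.
  have := h cu' z; rewrite lee_caddr dotBl (dotC z).
  by rewrite (_ : dot x z - c - _ = dot x z - dot y z - c) //; ring.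
have := h cu z; rewrite lee_caddr dotBl (dotC z).
by rewrite (_ : dot x z - c - _ = dot x z - dot y z - c) //; ring.
Qed.

Lemma conjugate_cst u s x : Conv_sc u ->
  conjugate (fun z => (u z + s%:E)%E) x = conjugate u x - s.
Proof.
move=> cu; have cu' := Conv_sc_cst s cu.
apply: eq_real_le => c; rewrite lerBlDr.
by split=> /conjugate_leP h; apply/conjugate_leP => // z; [have := h cu' z|have := h cu z];
  rewrite lee_caddr opprD addrA.
Qed.

Lemma conjugate_min u v x : Conv_sc u -> Conv_sc v ->
  Conv_sc (fun z => Order.min (u z) (v z)) ->
  conjugate (fun z => Order.min (u z) (v z)) x = Num.max (conjugate u x) (conjugate v x).
Proof.
move=> cu cv cm; apply: eq_real_le => c; rewrite ge_max; split.
  move/conjugate_leP => h; apply/andP; split; apply/conjugate_leP => // y;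
    by have := h cm y; rewrite le_min => /andP[].
case/andP => /conjugate_leP hu /conjugate_leP hv; apply/conjugate_leP => // y.
by rewrite le_min hu ?hv.
Qed.

(** Two points at which the supremum is nearly attained are joined by a segment on which
    the minimum stays low; by connectedness both functions are low at a common
    point of it. *)
Lemma conjugate_max u v x : Conv_sc u -> Conv_sc v ->
  Conv_sc (fun z => Order.max (u z) (v z)) ->
  Conv_sc (fun z => Order.min (u z) (v z)) ->
  conjugate (fun z => Order.max (u z) (v z)) x = Num.min (conjugate u x) (conjugate v x).
Proof.
move=> cu cv cM cm; apply/eqP; rewrite eq_le; apply/andP; split.
  rewrite le_min; apply/andP; split; apply/conjugate_leP => // y.
    apply: (@le_trans _ _ (u y)); last by rewrite le_max lexx.
    exact: conjugate_young.
  apply: (@le_trans _ _ (v y)); last by rewrite le_max lexx orbT.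
  exact: conjugate_young.
rewrite leNgt; apply/negP => lt; set M := conjugate _ x in lt.
pose a := (M + Num.min (conjugate u x) (conjugate v x)) / 2.
have Ma : M < a by rewrite /a; lra.
have am : a < Num.min (conjugate u x) (conjugate v x) by rewrite /a; lra.
move: am; rewrite lt_min => /andP[au av].
have [y1 /ltW h1] := conjugate_gtP cu au; have [y2 /ltW h2] := conjugate_gtP cv av.
pose g (t : R) : E := t *: y1 + (1 - t) *: y2.
have gc : continuous g.
  apply: (@lipschitz_continuous _ R^o _ _ (`|y1| + `|y2|)) => s t.
  have -> : g s - g t = (s - t) *: (y1 - y2).
    by apply/matrixP => i j; rewrite !mxE; ring.
  by rewrite normrZ mulrC ler_wpM2r // ler_normB.
have closedA f : Conv_sc f -> closed [set t | (f (g t) <= (dot x (g t) - a)%:E)%E].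
  move=> cf; have := Conv_sc_affine 0 (- x) a (unitmx1 _ _) cf.
  case=> _ /lower_semicontinuousP/(_ 0) op _ _ _.
  have := open_comp (fun t _ => gc t) op => /open_closedC; congr closed.
  apply/seteqP; split=> t /=; rewrite mul1mx addr0 dotNl ltNge => h.
    by move/negP: h; rewrite negbK lee_addc sub0r opprD opprK.
  by apply/negP; rewrite negbK lee_addc sub0r opprD opprK.
pose A f := [set t : R | (f (g t) <= (dot x (g t) - a)%:E)%E].
have disj t : A u t -> A v t -> False.
  move=> ut vt; have : (Order.max (u (g t)) (v (g t)) <= (dot x (g t) - a)%:E)%E.
    by rewrite ge_max ut vt.
  move/(conjugate_ge x cM); rewrite -/M => h; move: Ma; rewrite ltNge => /negP; apply.
  by apply: le_trans h; lra.
have cover t : 0 <= t <= 1 -> A u t \/ A v t.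
  move=> t01; move/Conv_scP: cm => [_ _ /(_ y1 y2 _ _ t t01) cm _ _].
  have := cm (dot x y1 - a) (dot x y2 - a); rewrite !ge_min h1 h2 orbT.
  move=> /(_ isT isT); rewrite -/(g t).
  rewrite (_ : t * _ + _ = dot x (g t) - a); last first.
    by rewrite /g dotDr !dotZr; ring.
  by move/orP.
have A1 : A u 1 by rewrite /A /= /g scale1r subrr scale0r addr0.
have A0 : A v 0 by rewrite /A /= /g scale0r add0r subr0 scale1r.
have e : `[0, 1]%classic `&` A u = `[0, 1]%classic.
  apply: segment_connected.
  - by exists 1; split=> //=; rewrite in_itv /= ler01 lexx.
  - exists (~` A v); first by apply: closed_openC; exact: closedA.
    apply/seteqP; split=> t /= [t01 h]; split=> //.
      by move=> vt; exact: (disj t).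
    by move: t01; rewrite in_itv => /cover[].
  - by exists (A u) => //; exact: closedA.
have : (`[0, 1]%classic `&` A u) 0.
  by rewrite e /= in_itv /= lexx ler01.
by move=> [_ /disj]; exact.
Qed.

Lemma conjugate_valuation u v x : Conv_sc u -> Conv_sc v ->
  Conv_sc (fun z => Order.max (u z) (v z)) ->
  Conv_sc (fun z => Order.min (u z) (v z)) ->
  conjugate (fun z => Order.max (u z) (v z)) x + conjugate (fun z => Order.min (u z) (v z)) x
  = conjugate u x + conjugate v x.
Proof.
by move=> cu cv cM cm; rewrite conjugate_min // conjugate_max // addr_min_max.
Qed.

(** Otherwise bad points closer and closer to [z], occurring at larger and larger
    indices, could be threaded into one sequence converging to [z]. *)
Lemma epi_cvg_near (u_ : nat -> E -> \bar R) u z a : epi_cvg u_ u ->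
  (a%:E < u z)%E -> \forall y \near z & i \near \oo, (a%:E <= u_ i y)%E.
Proof.
move=> uu az; apply: contrapT => far.
have bad (k : nat * nat) : exists p : nat * E,
    [/\ (k.2 <= p.1)%N, `|z - p.2| < k.1.+1%:R^-1 & (u_ p.1 p.2 < a%:E)%E].
  apply: contrapT => nb; apply: far.
  exists ([set y | `|z - y| < k.1.+1%:R^-1], [set i | (k.2 <= i)%N]).
    have e0 : 0 < k.1.+1%:R^-1 :> R by rewrite invr_gt0.
    by split; [exact: (near_dist z e0)|exists k.2].
  move=> [y i] /= [zy ki]; rewrite leNgt; apply/negP => ua; apply: nb.
  by exists (i, y).
have [f hf] := choice bad.
pose fix q (m : nat) : nat * E := f (m, if m is m'.+1 then (q m').1.+1 else 0%N).
have qz m : `|z - (q m).2| < m.+1%:R^-1.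
  by case: m => [|m]; [case: (hf (0, 0)%N)|case: (hf (m.+1, (q m).1.+1))].
have qa m : (u_ (q m).1 (q m).2 < a%:E)%E.
  by case: m => [|m]; [case: (hf (0, 0)%N)|case: (hf (m.+1, (q m).1.+1))].
have qS m : ((q m).1 < (q m.+1).1)%N by have [] := hf (m.+1, (q m).1.+1).
have qmono m k : (m < k)%N -> ((q m).1 < (q k).1)%N.
  elim: k => // k IH; rewrite ltnS leq_eqVlt => /orP[/eqP -> //|/IH h].
  exact: ltn_trans h (qS k).
have qge m : (m <= (q m).1)%N by elim: m => // m IH; exact: leq_ltn_trans IH (qS m).
pose x_ i := if pselect (exists m, (q m).1 = i) is left ex
  then (q (sval (cid ex))).2 else z.
have cx : x_ @ \oo --> z.
  apply/cvgrPdist_lt => e e0.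
  have := near_infty_natSinv_lt (PosNum e0); case=> M _ hM.
  exists (q M).1 => // i /= Mi; rewrite /x_; case: pselect => [ex|_]; last first.
    by rewrite subrr normr0.
  set m := sval _; have mi : (q m).1 = i by rewrite /m; case: cid.
  apply: lt_trans (qz m) (hM m _); rewrite /= leqNgt; apply/negP => /qmono.
  by rewrite mi ltnNge Mi.
have [N _ hN] := epi_cvg_liminf uu cx az.
have := hN _ (qge N); rewrite /x_; case: pselect => [ex|[]]; last by exists N.
set m := sval _; have mi : (q m).1 = (q N).1 by rewrite /m; case: cid.
by rewrite leNgt -mi qa.
Qed.

Lemma epi_cvg_compact (u_ : nat -> E -> \bar R) u x c (K : set E) :
  epi_cvg u_ u -> compact K -> (forall z, K z -> ((dot x z + c)%:E < u z)%E) ->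
  \forall i \near \oo, forall z, K z -> ((dot x z + c)%:E <= u_ i z)%E.
Proof.
move=> uu /compact_near_coveringP cK Ku.
apply: cK => z /Ku uz.
have [a [ca au]] : exists a : R, dot x z + c < a /\ (a%:E < u z)%E.
  case: (u z) uz => [r| |//]; last by exists (dot x z + c + 1); rewrite ltrDl ltr01 ltry.
  rewrite lte_fin => h; exists ((dot x z + c + r) / 2).
  by rewrite lte_fin; split; lra.
have near1 := epi_cvg_near uu au.
have near2 : \forall y \near z & i \near \oo, dot x y + c < a.
  have : \forall y \near z, dot x y < a - c.
    by apply: (cvgr_lt (dot x z) (@dot_continuous _ _ x z)); lra.
  move=> h; exists ([set y | dot x y < a - c], setT).
    by split => //; exact: filterT.
  by move=> [y i] /= [+ _]; lra.
apply: filterS2 near1 near2 => -[y i] /= h1 h2.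
by apply: le_trans h1; rewrite lee_fin ltW.
Qed.

(** Near the recovery point the bound is a compactness argument.  A point far away
    where [u_ i] is too low would, by convexity along the segment from the recovery
    point, make [u_ i] too low on a sphere where super-coercivity of [u] forbids it. *)
Lemma conjugate_epi_cvg (u_ : nat -> E -> \bar R) u x : (forall i, Conv_sc (u_ i)) ->
  Conv_sc u -> epi_cvg u_ u -> (fun i => conjugate (u_ i) x) @ \oo --> conjugate u x.
Proof.
move=> cu_ cu uu; apply/cvgrPdist_le => e e0.
set w := conjugate u x.
suff [lo up] : (\forall i \near \oo, w - e <= conjugate (u_ i) x) /\
               (\forall i \near \oo, conjugate (u_ i) x <= w + e).
  by apply: filterS2 lo up => i lo up; rewrite distrC ler_distl lo.
split.
  have [y /ltW uy] : exists y, (u y < (dot x y - (w - e / 2))%:E)%E.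
    by apply: conjugate_gtP => //; rewrite -/w; lra.
  have [y_ [cy hy]] := epi_cvg_recovery uu uy.
  have e4 : 0 < e / 4 by lra.
  have h1 : \forall i \near \oo, dot x y - e / 4 < dot x (y_ i).
    apply: (cvgr_gt (dot x y)); last by lra.
    exact: (cvg_comp _ _ cy (@dot_continuous _ _ x y)).
  apply: filterS2 h1 (hy _ e4) => i h1 /(conjugate_ge x (cu_ i)); lra.
have [_ _ _ [p [h0 up]] su] := (Conv_scP u).1 cu.
have [p_ [cp hp]] := epi_cvg_recovery uu up.
(* above the heights of both ends of the segment used below *)
pose M := Num.max (h0 + 2 - dot x p) (- (w + e)) + 1.
have [M1 M2] : h0 + 2 - dot x p < M /\ - (w + e) < M.
  by rewrite /M; split; rewrite ltr_pwDr // le_max lexx ?orbT.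
have [B hB] := su (n%:R * `|x| + 1).
(* so large that [u] exceeds [dot x + M] at distance at least [r - 1] from [p] *)
pose r := `|B| + `|M| + `|p| + 3.
have r0 : 0 < r by rewrite ltr_wpDl // !addr_ge0.
have big z : r - 1 <= `|z - p| -> ((dot x z + M)%:E < u z)%E.
  move=> zp; apply: lt_le_trans (hB z); rewrite lte_fin.
  have h1 : `|z - p| <= `|z| + `|p| by exact: ler_normB.
  have h2 : dot x z <= n%:R * `|x| * `|z|.
    exact: le_trans (ler_norm _) (dot_le_norm _ _).
  have := ler_norm B; have := ler_norm M; move: h2 h1 zp.
  by rewrite /r mulrDl mul1r; lra.
pose K := [set z : E | `|z - p| <= r + 1].
have cK : compact K by exact: compact_cball.
have cA : compact (K `&` [set z | r - 1 <= `|z - p|]).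
  apply: compact_closedI => //.
  rewrite (_ : [set z | _] = (fun z : E => `|z - p|) @^-1` [set s | r - 1 <= s]) //.
  apply: closed_comp => [z _|]; last exact: closed_ge.
  apply: (@lipschitz_continuous _ _ R^o _ 1) => {}z z'.
  rewrite mul1r; apply: le_trans (ler_dist_dist _ _) _.
  by rewrite opprB addrA subrK.
have near1 : \forall i \near \oo, forall z, K z -> ((dot x z + - (w + e))%:E <= u_ i z)%E.
  apply: epi_cvg_compact uu cK _ => z _.
  by apply: lt_le_trans (conjugate_young x z cu); rewrite lte_fin -/w; lra.
have near2 := epi_cvg_compact uu cA (fun z zA => big z zA.2).
have near3 : \forall i \near \oo, `|p - p_ i| < 1 by exact: cvgr_dist_lt.
have near4 : \forall i \near \oo, dot x p - 1 < dot x (p_ i).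
  apply: (cvgr_gt (dot x p)); last by lra.
  exact: (cvg_comp _ _ cp (@dot_continuous _ _ x p)).
have near5 := hp 1 ltr01.
near=> i; apply/conjugate_leP => // y.
have n3 : `|p - p_ i| < 1 by near: i.
have n4 : dot x p - 1 < dot x (p_ i) by near: i.
have n5 : (u_ i (p_ i) <= (h0 + 1)%:E)%E by near: i.
have n1 : forall z, K z -> ((dot x z + - (w + e))%:E <= u_ i z)%E by near: i.
have n2 : forall z, (K `&` [set z | r - 1 <= `|z - p|]) z ->
  ((dot x z + M)%:E <= u_ i z)%E by near: i.
have [yr|yr] := leP `|y - p_ i| r.
  apply: n1; rewrite /K /= -(subrK (p_ i) y) -addrA.
  apply: le_trans (ler_normD _ _) _; apply: lerD => //.
  by rewrite distrC ltW.
rewrite leNgt; apply/negP => /ltW uy.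
pose d := `|y - p_ i|; have d0 : 0 < d by exact: lt_trans yr.
pose t := r / d.
have t01 : 0 <= t <= 1.
  apply/andP; rewrite /t; split; first by rewrite divr_ge0 // ltW.
  by rewrite ler_pdivrMr // mul1r ltW.
have [_ _ /(_ _ _ _ _ _ t01 uy n5) + _ _] := (Conv_scP (u_ i)).1 (cu_ i).
set z := _ + _; have zp : z - p_ i = t *: (y - p_ i).
  by apply/matrixP => k j; rewrite !mxE; ring.
have zr : `|z - p_ i| = r.
  by rewrite zp normrZ ger0_norm ?divr_ge0 ?ltW // /t divfK // gt_eqF.
have zA : (K `&` [set z | r - 1 <= `|z - p|]) z.
  split; rewrite /K /=.
    rewrite -(subrK (p_ i) z) -addrA; apply: le_trans (ler_normD _ _) _.
    by rewrite zr lerD2l distrC ltW.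
  rewrite lerBlDr -zr -{1}(subrK p z) -addrA.
  apply: le_trans (ler_normD _ _) _; rewrite lerD2l; exact: ltW.
move/(le_trans (n2 z zA)); rewrite lee_fin /z dotDr !dotZr.
have /andP[t0 t1] := t01.
have t1' : 0 <= 1 - t by rewrite subr_ge0.
have [tz|tz] := eqVneq t 0.
  by rewrite tz; move: M1 n4; lra.
have tp : 0 < t by rewrite lt_neqAle eq_sym tz.
have e1 : t * - (w + e) < t * M by rewrite ltr_pM2l.
have : (1 - t) * (h0 + 1 - dot x (p_ i)) <= (1 - t) * M.
  by rewrite ler_wpM2l //; lra.
clearbody z w M t => e2 e3; clear -e1 e2 e3; lra.
Unshelve. all: by end_near. Qed.

End Legendre.

(** * Classification *)

Section Main.
Context {R : realType} {n : nat}.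
Local Notation E := 'cV[R]_n.
Implicit Types (x y z p q : E) (s d : R) (u v w : E -> \bar R).
Implicit Types (Z : (E -> \bar R) -> E -> R).

Lemma explicit_admissible Z (eps : R) (Z0 : (E -> \bar R) -> R) : eps != 0 ->
  explicit_form Z eps Z0 -> admissible Z eps Z0.
Proof.
move=> e0 [c [c' [sigma [s0 Z0E ZE]]]].
have {}ZE u x : Conv_sc u -> Z u x = eps * sigma * conjugate u (eps^-1 *: x) + c.
  move=> cu; have := ZE u x cu; rewrite (negbTE e0) -(conjugateE _ cu) -EFinM -EFinD.
  by case.
split.
- move=> u_ u cu_ cu uu x; rewrite ZE //.
  rewrite (_ : (fun i => Z (u_ i) x) =
    fun i => eps * sigma * conjugate (u_ i) (eps^-1 *: x) + c); last first.
    by apply/funext => i; rewrite ZE.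
  by apply: cvgD; [apply: cvgMl_tmp; exact: conjugate_epi_cvg|exact: cvg_cst].
- move=> u phi cu d1 x; have phiu := det1_unit d1.
  rewrite !ZE ?conjugate_mulmx // ?scalemxAr //.
  by apply: Conv_sc_mul; rewrite // unitmx_inv.
- move=> u v /= cu cv cM cm x; rewrite !ZE //.
  have := conjugate_valuation (eps^-1 *: x) cu cv cM cm.
  move=> h; transitivity (eps * sigma * (conjugate u (eps^-1 *: x) + conjugate v (eps^-1 *: x)) + c + c); last by ring.
  by rewrite -h; ring.
- by move=> u cu; rewrite Z0E.
move=> u y cu; split=> x.
  rewrite !ZE ?conjugate_tau //; last exact: Conv_sc_tau.
  by rewrite Z0E // dotZr dotZl; field.
rewrite /tau !ZE //; last exact: Conv_sc_lin.
by rewrite conjugate_lin // scalerBr scalerA mulVf // scale1r.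
Qed.

Lemma lin_lin u p q : (fun z => ((u z + (dot z p)%:E) + (dot z q)%:E)%E) =
  (fun z => (u z + (dot z (p + q))%:E)%E).
Proof. by apply/funext => z; rewrite -addeA -EFinD -dotDr. Qed.

Lemma lin0 u : (fun z => (u z + (dot z 0)%:E)%E) = u.
Proof. by apply/funext => z; rewrite dot0r adde0. Qed.

Lemma lin_cst u q d : (fun z => (u z + (dot q z + d)%:E)%E) =
  (fun z => ((u z + d%:E) + (dot z q)%:E)%E).
Proof. by apply/funext => z; rewrite -addeA -EFinD [d + _]addrC (dotC z). Qed.

Lemma tau_lin u q y : tau y (fun z => (u z + (dot z q)%:E)%E) =
  (fun z => (tau y u z + (- dot y q)%:E + (dot z q)%:E)%E).
Proof.
apply/funext => z; rewrite /tau dotBl -addeA -EFinD.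
by congr (_ + _%:E)%E; rewrite addrC.
Qed.

Lemma cst_cst u s d : (fun z => (u z + s%:E + d%:E)%E) = (fun z => (u z + (s + d)%:E)%E).
Proof. by apply/funext => z; rewrite -addeA -EFinD. Qed.

Section Forward.
Context (n_gt1 : (1 < n)%N).
Context (Z : (E -> \bar R) -> E -> R) (eps : R) (Z0 : (E -> \bar R) -> R).
Context (adm : admissible Z eps Z0).

Let Zcont x : epi_cont (fun u => Z u x).
Proof. by case: adm => zc _ _ _ _ u_ u cu_ cu uu; exact: zc. Qed.

Let Zsl u (phi : 'M[R]_n) x : Conv_sc u -> \det phi = 1 ->
  Z (fun y => u (invmx phi *m y)) x = Z u (phi^T *m x).
Proof. by case: adm => _ zs _ _ _ cu d1; exact: zs. Qed.

Let Zval u v x : Conv_sc u -> Conv_sc v ->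
  Conv_sc (fun x => Order.max (u x) (v x)) ->
  Conv_sc (fun x => Order.min (u x) (v x)) ->
  Z (fun x => Order.max (u x) (v x)) x + Z (fun x => Order.min (u x) (v x)) x
  = Z u x + Z v x.
Proof. by case: adm => _ _ zv _ _ cu cv cM cm; exact: zv. Qed.

Let Z0_ge0 u : Conv_sc u -> 0 <= Z0 u.
Proof. by case: adm => _ _ _ z0 _; exact: z0. Qed.

Let Ztau u y x : Conv_sc u -> Z (tau y u) x = Z u x + Z0 u * dot x y.
Proof. by case: adm => _ _ _ _ zt cu; have [-> _] := zt u y cu; rewrite dotZr. Qed.

Let Zlin u y x : Conv_sc u ->
  Z (fun z => (u z + (dot z y)%:E)%E) x = Z u (x - eps *: y).
Proof. by case: adm => _ _ _ _ zt cu; have [_ ->] := zt u y cu. Qed.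

Lemma exists_neq0 : exists e : E, e != 0.
Proof.
exists (const_mx 1); apply/eqP => /matrixP/(_ (Ordinal (ltnW n_gt1)) 0).
by rewrite !mxE => /eqP; rewrite oner_eq0.
Qed.

Lemma exists_orthogonal x : exists2 y, y != 0 & dot x y = 0.
Proof.
pose i0 := Ordinal (ltnW n_gt1); pose i1 := Ordinal n_gt1.
have [x0|x0] := eqVneq (x i0 0) 0.
  exists (delta_mx i0 0); last by rewrite dot_delta.
  apply/eqP => /matrixP/(_ i0 0); rewrite !mxE !eqxx => /eqP.
  by rewrite oner_eq0.
exists (x i1 0 *: delta_mx i0 0 - x i0 0 *: delta_mx i1 0); last first.
  by rewrite dotBr !dotZr !dot_delta; ring.
apply/eqP => /matrixP/(_ i1 0); rewrite !mxE !eqxx /= mulr0 mulr1 sub0r.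
by move/eqP; rewrite oppr_eq0 (negbTE x0).
Qed.

(** A shift by [y] orthogonal to [x] leaves the value at [x] unchanged, but it
    transforms a linear summand into itself plus the constant [- dot y q]. *)
Lemma eps0_affine u q d x : eps = 0 -> Conv_sc u ->
  Z (fun z => (u z + (dot q z + d)%:E)%E) x = Z u x.
Proof.
move=> e0 cu; rewrite lin_cst Zlin; last exact: Conv_sc_cst.
rewrite e0 scale0r subr0; have [y y0 xy] := exists_orthogonal x.
(* chosen so that the constant [- dot y p] produced by the shift is [d] *)
pose p := (- d / dot y y) *: y.
have yp : - dot y p = d.
  by rewrite /p dotZr divfK ?opprK // dot_self_eq0.
pose w := tau (- y) u; have cw : Conv_sc w by exact: Conv_sc_tau.
have tw : tau y w = u by apply/funext => z; rewrite /w /tau opprK subrK.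
have := Ztau y x (Conv_sc_lin p cw).
rewrite tau_lin tw yp xy mulr0 addr0 Zlin; last exact: Conv_sc_cst.
rewrite Zlin // e0 scale0r !subr0 => ->.
by rewrite -[in RHS]tw Ztau // xy mulr0 addr0.
Qed.

Lemma eps0_explicit : eps = 0 -> explicit_form Z eps Z0.
Proof.
move=> e0; pose I0 := hullf [:: (0 : E, 0 : R)].
have cI0 : Conv_sc I0 by exact: Conv_sc_hullf.
have ZE u x : Conv_sc u -> Z u x = Z I0 x.
  move=> cu; apply: (@affine_invariant_cst _ _ (fun v => Z v x)) => // v q d cv.
  exact: eps0_affine.
have [e ne0] := exists_neq0.
have Z0E u : Conv_sc u -> Z0 u = 0.
  move=> cu; have := Ztau e e cu; rewrite !ZE //; last exact: Conv_sc_tau.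
  move/eqP; rewrite -subr_eq0 opprD addNKr oppr_eq0 mulf_eq0 dot_self_eq0.
  by rewrite (negbTE ne0) orbF => /eqP.
exists (Z I0 e), (Z I0 0 - Z I0 e), 0; split=> // u x cu.
rewrite e0 eqxx ZE //; congr _%:E.
have [->|x0] := eqVneq x 0; first by rewrite mulr1 subrK.
rewrite mulr0 add0r; have [phi d1 phie] := SL_transitive n_gt1 ne0 x0.
have d1' : \det phi^T = 1 by rewrite det_tr.
have := Zsl e cI0 d1'; rewrite trmxK phie => <-.
by rewrite ZE //; apply: Conv_sc_mul; rewrite // unitmx_inv det1_unit.
Qed.

Context (eps0 : eps != 0).

Let Y u := Z u 0.

Let ZY u x : Conv_sc u -> Z u x = Y (fun z => (u z + (dot z (- (eps^-1 *: x)))%:E)%E).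
Proof.
by move=> cu; rewrite /Y Zlin // sub0r scalerN scalerA divff // scale1r opprK.
Qed.

Lemma Y_tau u y : Conv_sc u -> Y (tau y u) = Y u.
Proof. by move=> cu; rewrite /Y Ztau // dot0l mulr0 addr0. Qed.

(** The translation rule at [w + l_q], read through [ZY], compares [w] with its
    vertical translate. *)
Lemma Y_cst w q s : Conv_sc w -> q != 0 ->
  Y (fun z => (w z + (- s)%:E)%E) = Y w + eps * s * Z0 (fun z => (w z + (dot z q)%:E)%E).
Proof.
move=> cw q0; pose y := (s / dot q q) *: q.
have yq : dot y q = s by rewrite /y dotZl divfK // dot_self_eq0.
have cq := Conv_sc_lin q cw.
have := Ztau y (eps *: q) cq.
rewrite ZY; last exact: Conv_sc_tau.
rewrite (ZY (eps *: q) cq) scalerA mulVf // scale1r tau_lin !lin_lin subrr !lin0.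
rewrite yq -[fun z => (tau y w z + _)%E]/(tau y (fun z => (w z + (- s)%:E)%E)).
rewrite Y_tau; last exact: Conv_sc_cst.
by move=> ->; rewrite dotZl (dotC q) yq mulrC.
Qed.

(** The slope of [Y] along vertical translations. *)
Let D w := (Y (fun z => (w z + (- 1)%:E)%E) - Y w) / eps.

Lemma D_Z0 w q : Conv_sc w -> q != 0 -> Z0 (fun z => (w z + (dot z q)%:E)%E) = D w.
Proof.
move=> cw q0; rewrite /D (Y_cst 1 cw q0) mulr1.
by rewrite addrAC subrr add0r mulrC mulKf.
Qed.

Lemma Y_cstD w s : Conv_sc w -> Y (fun z => (w z + (- s)%:E)%E) = Y w + eps * s * D w.
Proof.
by move=> cw; have [q q0] := exists_neq0; rewrite -(D_Z0 cw q0); exact: Y_cst.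
Qed.

(** [D w] equals [Z0 (w + l_q)] for every nonzero [q], so a linear summand can be
    absorbed into [q]. *)
Lemma D_affine w q d : Conv_sc w ->
  D (fun z => (w z + (dot q z + d)%:E)%E) = D w.
Proof.
move=> cw; have cd := Conv_sc_cst d cw.
have Dd : D (fun z => (w z + d%:E)%E) = D w.
  rewrite /D cst_cst -[d - 1]opprK opprB -[d in X in _ - X]opprK !Y_cstD //.
  by rewrite -/(D w); field.
rewrite lin_cst -Dd; have [e e0] := exists_neq0.
have [->|q0] := eqVneq q 0; first by rewrite lin0.
(* [q] itself is a nonzero direction whose sum with [q] is nonzero *)
have q2 : q + q != 0 by rewrite -mulr2n -scaler_nat scaler_eq0 pnatr_eq0.
by rewrite -(D_Z0 (Conv_sc_lin q cd) q0) lin_lin (D_Z0 cd q2).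
Qed.

Lemma Y_cont : epi_cont Y.
Proof. exact: Zcont. Qed.

Lemma D_cont : epi_cont D.
Proof.
move=> u_ u cu_ cu uu; apply: cvgMr_tmp; apply: cvgB; last exact: Y_cont.
apply: (@Y_cont (fun i z => (u_ i z + (- 1)%:E)%E)).
- by move=> i; exact: Conv_sc_cst.
- exact: Conv_sc_cst.
by apply: epi_cvg_cst uu; case: cu.
Qed.

Lemma forward_explicit : explicit_form Z eps Z0.
Proof.
pose I0 := hullf [:: (0 : E, 0 : R)].
have cI0 : Conv_sc I0 by exact: Conv_sc_hullf.
pose sigma := D I0.
have DE u : Conv_sc u -> D u = sigma.
  by move=> cu; apply: (affine_invariant_cst D_cont) => // v q d cv; exact: D_affine.
have [e ne0] := exists_neq0.
have Z0E u : Conv_sc u -> Z0 u = sigma.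
  move=> cu; have cu' := Conv_sc_lin (- e) cu.
  by rewrite -(DE _ cu') -(D_Z0 cu' ne0) lin_lin addNr lin0.
pose Y' u := Y u - eps * sigma * conjugate u 0.
have Y'E u : Conv_sc u -> Y' u = Y' I0.
  apply: (invariant_valuation_cst n_gt1).
  - move=> u_ v cu_ cv uv; apply: cvgB; first exact: Y_cont.
    by apply: cvgMl_tmp; exact: conjugate_epi_cvg.
  - move=> v w cv cw cM cm; rewrite /Y' /Y.
    have := Zval 0 cv cw cM cm; have := conjugate_valuation 0 cv cw cM cm.
    move=> h1 h2; transitivity (Z v 0 + Z w 0 - eps * sigma * (conjugate v 0 + conjugate w 0)).
      by rewrite -h1 -h2; ring.
    by ring.
  - move=> v phi cv d1; rewrite /Y' /Y Zsl // conjugate_mulmx ?mulmx0 //.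
    exact: det1_unit.
  - by move=> v y cv; rewrite /Y' Y_tau // conjugate_tau // dot0l addr0.
  move=> v d cv; have := Y_cstD (- d) cv; rewrite opprK DE // /Y' conjugate_cst // => ->.
  by ring.
exists (Y' I0), 0, sigma; split=> [|//|u x cu]; first by rewrite -(Z0E _ cI0) Z0_ge0.
rewrite (negbTE eps0) -conjugateE // -EFinM -EFinD; congr _%:E.
rewrite ZY //; set v := fun z => _; have cv : Conv_sc v by exact: Conv_sc_lin.
have := Y'E v cv; rewrite /Y' /v conjugate_lin // sub0r opprK.
by move=> <-; rewrite addrC subrK.
Qed.

End Forward.
End Main.

(* The first clause is the equivalence, for each eps. The other two tie the
   function Z0 on both sides. For eps = 0 the explicit form makes Z invariant
   under translations of u, so it is compatible with the translation rule only
   for Z0 = 0, while sigma does not occur in it: the converse with the same Z0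
   is therefore restricted to eps <> 0. *)
Theorem theorem5p3 (R : realType) (n : nat) (hn : (3 <= n)%N)
    (Z : ('cV[R]_n -> \bar R) -> 'cV[R]_n -> R) (eps : R) :
  [/\ (exists Z0 : ('cV[R]_n -> \bar R) -> R, admissible Z eps Z0) <->
      (exists Z0 : ('cV[R]_n -> \bar R) -> R, explicit_form Z eps Z0),
      forall Z0 : ('cV[R]_n -> \bar R) -> R,
        admissible Z eps Z0 -> explicit_form Z eps Z0 &
      eps != 0 -> forall Z0 : ('cV[R]_n -> \bar R) -> R,
        explicit_form Z eps Z0 -> admissible Z eps Z0].
Proof.
have n_gt1 : (1 < n)%N by exact: leq_trans hn.
have forward Z0 : admissible Z eps Z0 -> explicit_form Z eps Z0.
  have [e0|e0] := eqVneq eps 0; first by move/eps0_explicit; exact.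
  by move/forward_explicit; exact.
split=> //; last by move=> e0 Z0; exact: explicit_admissible.
split=> [[Z0 /forward]|[Z0 ex]]; first by exists Z0.
have [e0|e0] := eqVneq eps 0; last by exists Z0; exact: explicit_admissible.
exists (fun=> 0); case: ex => c [c' [sigma [_ _ ZE]]].
have {}ZE u x : Conv_sc u -> Z u x = c' * (x == 0)%:R + c.
  by move=> cu; have := ZE u x cu; rewrite e0 eqxx => -[].
split=> //.
- move=> u_ u cu_ cu _ x; rewrite ZE //.
  rewrite (_ : (fun i => Z (u_ i) x) = fun=> c' * (x == 0)%:R + c); last first.
    by apply/funext => i; rewrite ZE.
  exact: cvg_cst.
- move=> u phi cu d1 x; have phiu := det1_unit d1.
  rewrite !ZE //; last by apply: Conv_sc_mul; rewrite // unitmx_inv.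
  have phitu : phi^T \in unitmx by rewrite unitmx_tr.
  suff -> : (phi^T *m x == 0) = (x == 0) by [].
  apply/eqP/eqP => [h|->]; last by rewrite mulmx0.
  by rewrite -(mulKmx phitu x) h mulmx0.
- by move=> u v /= cu cv cM cm x; rewrite !ZE.
move=> u y cu; split=> x.
  by rewrite scale0r dot0r addr0 !ZE //; exact: Conv_sc_tau.
by rewrite /tau e0 scale0r subr0 !ZE //; exact: Conv_sc_lin.
Qed.
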